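(* Let $\Omega\subseteq\mathbb{R}^2$ be an open convex set and $D\subseteq\Omega$ be an open connected set. Let $f,g\in\mathrm{Conv}(\Omega)$ be of class $C^2$, and suppose that $$\mathsf{D}_2(\nabla^2f,\nabla^2g)=0\quad\text{on }D.$$ Let $$R=\{x\in D:\nabla^2f=0\text{ in a neighborhood of }x\}\cup\{x\in D:\nabla^2g=0\text{ in a neighborhood of }x\}.$$ Then for every $x\in D\setminus R$, there is an affine line $L\subset\mathbb{R}^2$ with $x\in L$ such that $f$ and $g$ are both affine on the connected component $I$ of $L\cap D$ that contains $x$, and $I\cap R=\varnothing$.
   Context: $\mathrm{Conv}(\Omega)$ is the set of all proper convex functions $f:\mathbb{R}^2\to(-\infty,\infty]$ with $\Omega\subseteq\mathrm{dom}\,f$; ''of class $C^2$'' refers to $f,g$ on $\Omega$. $\mathsf{D}_2(M_1,M_2)$ denotes the mixed discriminant of symmetric $2\times2$ matrices, i.e. the symmetric bilinear form determined by $\det(\lambda_1M_1+\lambda_2M_2)=\lambda_1^2\det M_1+2\lambda_1\lambda_2\mathsf{D}_2(M_1,M_2)+\lambda_2^2\det M_2$. *)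

(* Defs.v *)
From mathcomp Require Import all_boot all_order all_algebra.
From mathcomp Require Import all_classical all_reals all_analysis.
From mathcomp Require Import ring.

Set Implicit Arguments.
Unset Strict Implicit.
Unset Printing Implicit Defensive.

Import Order.TTheory GRing.Theory Num.Theory.
Import numFieldNormedType.Exports.

Local Open Scope classical_set_scope.
Local Open Scope ring_scope.

Definition effective_domain (T : Type) (R : realType) (f : T -> \bar R) : set T :=
  [set x | (f x < +oo)%E].

Definition proper_function (T : Type) (R : realType) (f : T -> \bar R) : Prop :=
  (forall x, f x != -oo%E) /\ effective_domain f !=set0.

(* The endpoints t = 0 and t = 1 impose nothing, since 0 * +oo = 0 in \bar R. *)
Definition econvex_function (R : realType) (E : lmodType R) (f : E -> \bar R) :
    Prop :=
  forall (x y : E) (t : R), 0 <= t <= 1 ->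
    (f (t *: x + (1 - t) *: y)%R <= t%:E * f x + (1 - t)%:E * f y)%E.

Definition Conv (R : realType) (Omega : set 'rV[R]_2) :
    set ('rV[R]_2 -> \bar R) :=
  [set f | [/\ proper_function f, econvex_function f &
               Omega `<=` effective_domain f]].

(* All derivatives are taken in the whole space, and the total operator 'D_v F
   is meaningful only where F is derivable along v: C1_on and C2_on are meant
   for open A, and partial and hessian for points around which F is C2. *)
Definition partial (R : realType) (n : nat) (F : 'rV[R]_n -> R) (i : 'I_n) :
    'rV[R]_n -> R :=
  'D_(delta_mx 0 i) F.

Definition C1_on (R : realType) (n : nat) (A : set 'rV[R]_n)
    (F : 'rV[R]_n -> R) : Prop :=
  forall x, A x ->
    {for x, continuous F} /\
    forall i : 'I_n, derivable F x (delta_mx 0 i) /\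
                     {for x, continuous (partial F i)}.

Definition C2_on (R : realType) (n : nat) (A : set 'rV[R]_n)
    (F : 'rV[R]_n -> R) : Prop :=
  C1_on A F /\ forall i : 'I_n, C1_on A (partial F i).

Definition hessian (R : realType) (n : nat) (F : 'rV[R]_n -> R)
    (x : 'rV[R]_n) : 'M[R]_n :=
  \matrix_(i, j) partial (partial F j) i x.

Definition locally_zero_hessian (R : realType) (n : nat) (A : set 'rV[R]_n)
    (F : 'rV[R]_n -> R) : set 'rV[R]_n :=
  [set x | A x /\ \forall y \near x, hessian F y = 0].

Definition affine_line (R : realType) (n : nat) (L : set 'rV[R]_n) : Prop :=
  exists p v : 'rV[R]_n, v != 0 /\ L = range (fun t : R => p + t *: v).

Definition affine_on (R : realType) (E : lmodType R) (A : set E)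
    (f : E -> \bar R) : Prop :=
  exists (l : {scalar E}) (c : R), forall x, A x -> f x = (l x + c)%:E.

Lemma det_mx22 (R : comNzRingType) (M : 'M[R]_2) :
  \det M = M 0 0 * M 1 1 - M 0 1 * M 1 0.
Proof.
rewrite (expand_det_row _ 0) big_ord_recl big_ord1 /cofactor !det_mx11 !mxE.
have l0 : lift 0 0 = 1 :> 'I_2 by apply/val_inj.
have l1 : lift 1 0 = 0 :> 'I_2 by apply/val_inj.
by rewrite !l0 !l1 /= expr0 expr1 mul1r mulN1r mulrN.
Qed.

(* Polarization of \det; mixed_discriminantC, _linearl and _expand show that it
   is the symmetric bilinear form occurring in \det (a *: M + b *: N). *)
Definition mixed_discriminant (R : numFieldType) (M N : 'M[R]_2) : R :=
  (\det (M + N) - \det M - \det N) / 2.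

Lemma mixed_discriminantC (R : numFieldType) (M N : 'M[R]_2) :
  mixed_discriminant M N = mixed_discriminant N M.
Proof. by rewrite /mixed_discriminant [M + N]addrC addrAC. Qed.

Lemma mixed_discriminant_linearl (R : numFieldType) (a : R) (M M' N : 'M[R]_2) :
  mixed_discriminant (a *: M + M') N =
  a * mixed_discriminant M N + mixed_discriminant M' N.
Proof. by rewrite /mixed_discriminant !det_mx22 !mxE; field. Qed.

Lemma mixed_discriminant_expand (R : numFieldType) (a b : R) (M N : 'M[R]_2) :
  \det (a *: M + b *: N) =
  a ^+ 2 * \det M + 2 * a * b * mixed_discriminant M N + b ^+ 2 * \det N.
Proof. by rewrite /mixed_discriminant !det_mx22 !mxE; field. Qed.

(* Main.v *)
From HB Require Import structures.
Require Import Defs.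
From mathcomp Require Import all_boot all_order all_algebra.
From mathcomp Require Import all_classical all_reals all_analysis.
From mathcomp Require Import ring lra.
Set Implicit Arguments.
Unset Strict Implicit.
Unset Printing Implicit Defensive.
Import Order.TTheory GRing.Theory Num.Theory.
Import numFieldNormedType.Exports.
Local Open Scope classical_set_scope.
Local Open Scope ring_scope.

(** Write u = f + g, and A, B for the Hessians of f and g. Two positive
semidefinite plane forms with zero mixed discriminant are such that one of them
vanishes or both have rank one and the same kernel; in particular A e and B e
are parallel for every vector e ([pair_parallel]). So, with d_e for the
derivative in the direction e, the functions d_e u and d_e g have parallel
gradients, and d_e g ought to be constant on the level sets of d_e u. This is
true between two points of a level set as soon as that level set stays away
from the boundary of a compact region containing them ([grad_le_of_strip]); the
proof is a maximum principle and avoids any regularity of the level set.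

The contact set of a point x of D consists of the points at which f and g both
agree with their tangent planes at x; it is convex. The main point is that an x
at which neither f nor g is locally affine is not an extreme point of its
contact set ([contact_segment_exists]). Otherwise a cap of the graph of u could
be cut off around x inside D ([extreme_cap]). Sliding a small paraboloid under
the cap yields a point p0 of it where A + B is positive definite
([cap_pos_def]); there A or B must vanish, say B, and then g is affine near p0.
Every p near p0 is the bottom of a tilted cap that still surrounds x, so for q
near x the constancy above applies to p and q in the direction orthogonal to
grad u (q) - grad u (p). Hence grad g (q) - grad g (p0) is parallel to
grad u (q) - grad u (p) for all p near p0. As A + B is nondegenerate at p0,
these vectors do not all lie on one line, so grad g (q) = grad g (p0) for all q
near x: g is affine near x, a contradiction ([grad_const_propagates]).

So the contact set of x contains a segment with midpoint x; let L be the line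
carrying it. Local affinity of f or g at a contact point on L would spread to x
by convexity ([flat_spreads]), so the same conclusion holds at every contact
point on L inside D; the segment obtained there lies on L again, since two
crossing segments would make x an interior point of its contact set
([contact_cross]). The contact set is therefore open and closed in the component
of x in the intersection of L and D, which gives the theorem
([component_contact]). *)

(** * Directional derivatives *)

Section line_derivative.
Context {R : realType} {V : normedModType R}.
Implicit Types (f : V -> R) (x v : V) (l c : R).

(** The form in which derivatives are computed and used below: no quotient, and
no exception at [h = 0]. *)
Lemma is_derive_epsP f x v l : is_derive x v f l <->
  forall e, 0 < e ->
    \forall h \near (0 : R), `|f (x + h *: v) - f x - h * l| <= e * `|h|.
Proof.
pose q h : R := h^-1 *: ((f \o shift x) (h *: v) - f x).
have qE (h e : R) : h != 0 ->
    (`|l - q h| <= e) = (`|f (x + h *: v) - f x - h * l| <= e * `|h|).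
  move=> h0; have h0' : 0 < `|h| by rewrite normr_gt0.
  rewrite -(ler_pM2r h0') -normrM distrC /q /=; congr (_ <= _); congr (`| _ |).
  by rewrite mulrBl [_ *: _]mulrC divfK// (mulrC l) [h *: v + x]addrC.
have lq : is_derive x v f l <-> q @ 0^' --> l.
  split=> [[fxv <-]//|ql].
  by apply: DeriveDef; [apply/cvg_ex; exists l|exact/cvg_lim].
rewrite lq; split=> [/cvgrPdist_le ql e e0|fl].
  have := ql _ e0; rewrite !near_withinE => ql'.
  near=> h; have [->|h0] := eqVneq h 0.
    by rewrite scale0r addr0 subrr mul0r subrr normr0 mulr0.
  by rewrite -qE//; move: h0; near: h; exact: ql'.
apply/cvgrPdist_le => e e0; rewrite near_withinE.
near=> h => h0; rewrite qE//; near: h; exact: fl.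
Unshelve. all: by end_near. Qed.

Lemma near0_pos (P : R -> Prop) : (\forall h \near (0 : R), P h) ->
  exists2 h, 0 < h & P h.
Proof.
move=> /nbhs_ballP[d /= d0 dP]; exists (d / 2); first exact: divr_gt0.
by apply: dP; rewrite /ball /= sub0r normrN gtr0_norm ?divr_gt0//; lra.
Qed.

Lemma is_derive_dirZ f x v l a :
  is_derive x v f l -> is_derive x (a *: v) f (a * l).
Proof.
move=> /is_derive_epsP fl; apply/is_derive_epsP => e e0.
have a1 : 0 < `|a| + 1 by rewrite ltr_wpDl.
have ha : (h * a) @[h --> (0 : R)] --> (0 : R).
  by rewrite -[X in _ --> X](mul0r a); apply: cvgMl.
near=> h; rewrite scalerA mulrA.
have : `|f (x + (h * a) *: v) - f x - h * a * l| <= e / (`|a| + 1) * `|h * a|.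
  by near: h; have := ha _ (fl _ (divr_gt0 e0 a1)); exact.
move=> /le_trans; apply; rewrite normrM -mulrA.
apply: ler_wpM2l; first exact: ltW.
by rewrite ler_pdivrMl// mulrC ler_wpM2r// lerDl.
Unshelve. all: by end_near. Qed.

(** One-sided comparison with a line of slope [c]: the case [c = 0] is Fermat's
rule at a one-sided maximum, and other slopes give the tangent inequality. *)
Lemma is_derive_le f x v l c : is_derive x v f l ->
  (\forall h \near (0 : R), 0 < h -> f (x + h *: v) <= f x + h * c) -> l <= c.
Proof.
move=> /is_derive_epsP fl fc; rewrite leNgt; apply/negP => cl.
have e0 : 0 < (l - c) / 2 by rewrite divr_gt0// subr_gt0.
have [h h0 [/(_ h0) fh]] := near0_pos (filterI fc (fl _ e0)).
rewrite (gtr0_norm h0) ler_norml => /andP[lh _].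
suff : 0 < h * ((l - c) / 2) by lra.
exact: mulr_gt0.
Qed.

Lemma is_derive_ge f x v l c : is_derive x v f l ->
  (\forall h \near (0 : R), 0 < h -> f x + h * c <= f (x + h *: v)) -> c <= l.
Proof.
move=> fl fc; rewrite -lerN2; apply: (@is_derive_le (- f) x v).
apply: filterS fc => h fc h0; have := fc h0; rewrite /= !fctE; lra.
Qed.

End line_derivative.

Lemma MVT_line (R : realType) (V : normedModType R) (f df : V -> R) (x v : V) :
  (forall t, 0 <= t <= 1 -> is_derive (x + t *: v) v f (df (x + t *: v))) ->
  exists2 t, 0 < t < 1 & f (x + v) - f x = df (x + t *: v).
Proof.
move=> fdf; pose phi t : R := f (x + t *: v).
have phid (t : R) : 0 <= t <= 1 -> is_derive t 1 phi (df (x + t *: v)).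
  move=> /fdf/is_derive_epsP fd; apply/is_derive_epsP => e /fd.
  apply: filterS => h; rewrite /phi scalerDl addrA.
  by rewrite [h *: (1 : R)]mulr1.
have [||t] := @MVT _ phi (fun t => df (x + t *: v)) 0 1 ltr01.
- by move=> t t01; apply: phid; rewrite !ltW ?(itvP t01).
- apply: derivable_within_continuous => t t01.
  by have [] := phid t; rewrite ?(itvP t01).
- rewrite in_itv /= => t01 phiE; exists t => //.
  by move: phiE; rewrite /phi scale0r addr0 scale1r subr0 mulr1.
Qed.

(** The derivative of the function maximized in [grad_le_of_strip]. *)
Lemma is_derive_penalized (R : realType) (W : normedModType R) (h V s : W -> R)
    (x w : W) (dh dV ds N eta : R) :
  is_derive x w h dh -> is_derive x w V dV -> is_derive x w s ds ->
  is_derive x w (fun y => h y - N * (V y * V y) + eta * s y)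
    (dh - N * (2 * V x * dV) + eta * ds).
Proof.
move=> hd Vd sd.
have VV := is_deriveM Vd Vd; have NVV := is_deriveZ N VV.
have es := is_deriveZ eta sd; have all := is_deriveD (is_deriveB hd NVV) es.
apply: (is_derive_eq all); rewrite /GRing.scale /=; ring.
Qed.

Section gradient.
Context {R : realType} {n : nat}.
Notation E := 'rV[R]_n.
Implicit Types (F : E -> R) (x v w : E) (A : set E).

Definition dot v w : R := \sum_i v 0 i * w 0 i.
Definition grad F x : E := \row_i partial F i x.
(** The second derivative of [F] in the directions [v] and [w]; symmetric when
[F] is C2, by [partialC]. *)
Definition hess F x v w : R :=
  \sum_i v 0 i * dot w (grad (partial F i) x).

Lemma dotC v w : dot v w = dot w v.
Proof. by apply: eq_bigr => i _; rewrite mulrC. Qed.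

Lemma dotDl v v' w : dot (v + v') w = dot v w + dot v' w.
Proof. by rewrite -big_split; apply: eq_bigr => i _; rewrite mxE mulrDl. Qed.

Lemma dotZl a v w : dot (a *: v) w = a * dot v w.
Proof. by rewrite mulr_sumr; apply: eq_bigr => i _; rewrite mxE mulrA. Qed.

Lemma dotNl v w : dot (- v) w = - dot v w.
Proof. by rewrite -scaleN1r dotZl mulN1r. Qed.

Lemma dotBl v v' w : dot (v - v') w = dot v w - dot v' w.
Proof. by rewrite dotDl dotNl. Qed.

Lemma dotDr v w w' : dot v (w + w') = dot v w + dot v w'.
Proof. by rewrite !(dotC v) dotDl. Qed.

Lemma dotZr a v w : dot v (a *: w) = a * dot v w.
Proof. by rewrite !(dotC v) dotZl. Qed.

Lemma dotBr v w w' : dot v (w - w') = dot v w - dot v w'.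
Proof. by rewrite !(dotC v) dotBl. Qed.

Lemma dot0l w : dot 0 w = 0. Proof. by rewrite -(scale0r 0) dotZl mul0r. Qed.

Lemma dot_ge0 v : 0 <= dot v v.
Proof. by apply: sumr_ge0 => i _; rewrite -expr2 sqr_ge0. Qed.

Lemma dot_eq0 v : (dot v v == 0) = (v == 0).
Proof.
apply/idP/eqP => [|->]; last by rewrite dot0l.
rewrite psumr_eq0 => [/allP vv|i _]; last by rewrite -expr2 sqr_ge0.
apply/rowP => i; rewrite mxE; apply/eqP; rewrite -sqrf_eq0 expr2.
exact/vv/mem_index_enum.
Qed.

Lemma coord_norm v i : `|v 0 i| <= `|v|.
Proof.
by rewrite [leRHS]/Num.norm /= mx_normrE; apply/bigmax_geP; right; exists (0, i).
Qed.

Lemma delta_norm (i : 'I_n) : `|delta_mx 0 i : E| <= 1.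
Proof.
rewrite /Num.norm /= mx_normrE; apply/bigmax_leP; split=> // -[j k] _ /=.
by rewrite mxE; case: andP; rewrite ?normr1 ?normr0.
Qed.

Lemma dot_le v w : `|dot v w| <= n%:R * (`|v| * `|w|).
Proof.
apply: le_trans (ler_norm_sum _ _ _) _.
have -> : n%:R * (`|v| * `|w|) = \sum_(i < n) `|v| * `|w|.
  by rewrite sumr_const card_ord mulr_natl.
by apply: ler_sum => i _; rewrite normrM ler_pM// coord_norm.
Qed.

Lemma dot_continuous v : continuous (dot v).
Proof.
move=> x.
apply: (@cvg_big _ _ _ _ _ (@add_continuous R) _ (nbhs x)) => i _.
by apply: cvgMr; have := @coord_continuous R 1 n 0 i x; exact.
Qed.

(** A function with continuous partial derivatives has all its directional
derivatives: moving one coordinate at a time, the mean value theorem bounds the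
error of each move by the oscillation of a partial derivative. *)
Lemma C1_is_derive A F x v : open A -> C1_on A F -> A x ->
  is_derive x v F (dot v (grad F x)).
Proof.
move=> oA FA Ax; apply/is_derive_epsP => e e0.
pose S := \sum_i `|v 0 i| + 1.
have S0 : 0 < S by rewrite ltr_wpDl// sumr_ge0.
have eS0 : 0 < e / S by rewrite divr_gt0.
have : \forall y \near x, A y /\ forall i, `|partial F i y - partial F i x| <= e / S.
  near=> y; split; first by near: y; exact: open_nbhs_nbhs.
  near: y; apply: filter_forall => i.
  have [_ /(_ i)[_ /cvgrPdist_le/(_ _ eS0)]] := FA _ Ax.
  by apply: filterS => y; rewrite [leLHS]distrC; exact.
move=> /nbhs_ballP[d /= d0]; rewrite -ball_normE /= => dP.
have step (s : seq 'I_n) (h : R) : `|h| * \sum_(i <- s) `|v 0 i| < d ->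
  `|F (x + \sum_(i <- s) (h * v 0 i) *: delta_mx 0 i) - F x
    - h * \sum_(i <- s) v 0 i * partial F i x|
  <= e / S * (`|h| * \sum_(i <- s) `|v 0 i|).
  elim: s => [|i s IHs].
    by rewrite !big_nil !mulr0 addr0 subrr subr0 normr0.
  rewrite !big_cons !mulrDr => hd.
  have hsd : `|h| * \sum_(j <- s) `|v 0 j| < d.
    by apply: le_lt_trans hd; rewrite lerDr mulr_ge0.
  set z := x + \sum_(j <- s) _ in IHs *.
  have zt (t : R) : 0 <= t <= 1 ->
      `|x - (z + t *: ((h * v 0 i) *: delta_mx 0 i))| < d.
    move=> /andP[t0 t1]; apply: le_lt_trans hd.
    rewrite /z -addrA opprD addNKr normrN addrC.
    apply: le_trans (ler_normD _ _) _; apply: lerD.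
      rewrite normrZ (ger0_norm t0) normrZ.
      by rewrite -normrM mulrCA ler_piMr// mulr_ile1// delta_norm.
    apply: le_trans (ler_norm_sum _ _ _) _; rewrite mulr_sumr.
    by apply: ler_sum => j _; rewrite normrZ normrM ler_piMr// delta_norm.
  have [t|t t01 Fz] := @MVT_line R E F
      (fun y => h * v 0 i * partial F i y) z ((h * v 0 i) *: delta_mx 0 i).
    move=> t01; have [/FA[_ /(_ i)[Fi _]] _] := dP _ (zt _ t01).
    exact: is_derive_dirZ (derivableP Fi).
  have -> : x + ((h * v 0 i) *: delta_mx 0 i
      + \sum_(j <- s) (h * v 0 j) *: delta_mx 0 j)
      = z + (h * v 0 i) *: delta_mx 0 i 
    by rewrite /z -addrA; congr (x + _); exact: addrC.
  have /dP[_ /(_ i) Fiy] : `|x - (z + t *: ((h * v 0 i) *: delta_mx 0 i))| < d.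
    by apply: zt; case/andP: t01 => /ltW -> /ltW ->.
  have -> : F (z + (h * v 0 i) *: delta_mx 0 i) - F x
      - (h * (v 0 i * partial F i x) + h * \sum_(j <- s) v 0 j * partial F j x)
      = h * v 0 i * (partial F i (z + t *: ((h * v 0 i) *: delta_mx 0 i))
                     - partial F i x)
        + (F z - F x - h * \sum_(j <- s) v 0 j * partial F j x).
    by rewrite -[F (z + _)](subrK (F z)) Fz; ring.
  apply: le_trans (ler_normD _ _) _; apply: lerD; last exact: IHs.
  by rewrite !normrM [leRHS]mulrC ler_wpM2l// mulr_ge0.
near=> h.
have hv : \sum_i (h * v 0 i) *: delta_mx 0 i = h *: v.
  rewrite [in RHS](row_sum_delta v) scaler_sumr.
  by apply: eq_bigr => i _; rewrite scalerA.
have SE : \sum_i v 0 i * partial F i x = dot v (grad F x).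
  by apply: eq_bigr => i _; rewrite mxE.
have hd : `|h| * \sum_i `|v 0 i| < d.
  have hS : `|h| * S < d.
    rewrite -ltr_pdivlMr//; near: h.
    apply: (@nbhs0_lt R R); rewrite divr_gt0//.
  by apply: le_lt_trans hS; rewrite ler_wpM2l// lerDl.
have := step (index_enum 'I_n) h hd; rewrite hv SE => /le_trans; apply.
rewrite mulrCA [leRHS]mulrC ler_wpM2l// -mulrA.
apply: ler_piMr; first exact: ltW.
by rewrite ler_pdivrMl// mulr1 lerDl.
Unshelve. all: by end_near. Qed.

End gradient.

Lemma is_derive_translate (R : realType) (V : normedModType R) (f : V -> R)
    (a x v : V) l :
  is_derive (x + a) v f l -> is_derive x v (fun y => f (y + a)) l.
Proof.
move=> /is_derive_epsP fl; apply/is_derive_epsP => e /fl.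
by apply: filterS => h; rewrite [x + a + _]addrAC.
Qed.

Section second_derivative.
Context {R : realType} {n : nat}.
Notation E := 'rV[R]_n.
Implicit Types (F : E -> R) (x v w : E) (A : set E).

Lemma dot_delta i w : dot (delta_mx 0 i) w = w 0 i.
Proof.
rewrite /dot (bigD1 i)//= mxE !eqxx mul1r big1 ?addr0// => j ji.
by rewrite mxE (negbTE ji) mul0r.
Qed.

Lemma grad_continuous A F v x : C1_on A F -> A x ->
  {for x, continuous (fun y => dot v (grad F y))}.
Proof.
move=> FA Ax.
apply: (@cvg_big _ _ _ _ _ (@add_continuous R) _ (nbhs x)) => i _.
rewrite mxE; under eq_fun do rewrite mxE.
by apply: cvgMr; have [_ /(_ i)[]] := FA _ Ax.
Qed.

Lemma grad_is_derive A F x v w : open A -> C2_on A F -> A x ->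
  is_derive x w (fun y => dot v (grad F y)) (hess F x v w).
Proof.
move=> oA [_ FA] Ax.
have -> : (fun y => dot v (grad F y)) = \sum_i (v 0 i *: partial F i).
  apply/funext => y; rewrite fct_sumE.
  by apply: eq_bigr => i _; rewrite mxE.
apply: is_derive_sum => i; apply: is_deriveZ.
exact: C1_is_derive (FA i) Ax.
Qed.

Lemma C2_is_derive A F x v : open A -> C2_on A F -> A x ->
  is_derive x v F (dot v (grad F x)).
Proof. by move=> oA [FA _]; exact: C1_is_derive. Qed.

Lemma continuous_eq_at (p q : E -> R) x :
  {for x, continuous p} -> {for x, continuous q} ->
  (forall d, 0 < d -> exists y z, [/\ `|x - y| < d, `|x - z| < d & p y = q z]) ->
  p x = q x.
Proof.
move=> /cvgrPdist_lt cp /cvgrPdist_lt cq pq; apply/eqP; apply: contraT => neq.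
have e0 : 0 < `|p x - q x| / 2 by rewrite divr_gt0// normr_gt0 subr_eq0.
have [d /= d0] := (nbhs_ballP _ _).1 (filterI (cp _ e0) (cq _ e0)).
rewrite -ball_normE => dP; have [y [z [/dP[py _] /dP[_ qz] yz]]] := pq _ d0.
have : `|p x - q x| <= `|p x - p y| + `|q x - q z|.
  by rewrite (distrC (q x)) -yz; exact: ler_distD.
by move=> /le_lt_trans/(_ (ltrD py qz)); rewrite -splitr ltxx.
Qed.

(** Schwarz's theorem: both iterated derivatives are limits of the same second
difference quotient, symmetric in the two directions. *)
Lemma partialC A F x i j : open A -> C2_on A F -> A x ->
  partial (partial F j) i x = partial (partial F i) j x.
Proof.
move=> oA FA Ax; apply: continuous_eq_at.
- by have [_ /(_ i)[_]] := FA.2 j _ Ax.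
- by have [_ /(_ j)[_]] := FA.2 i _ Ax.
move=> d' d'0.
have [d0 /= d00] := (nbhs_ballP _ _).1 (open_nbhs_nbhs (conj oA Ax)).
rewrite -ball_normE /= => d0A.
pose d := Num.min d' d0; have d_gt0 : 0 < d by rewrite lt_min d'0.
have dP y : `|x - y| < d -> A y.
  by move=> xy; apply: d0A; apply: lt_le_trans xy _; rewrite ge_min lexx orbT.
have [h h0 hd] : exists2 h : R, 0 < h & h + h < d.
  by exists (d / 4); [rewrite divr_gt0|lra].
have near_x k l s t : 0 <= s <= 1 -> 0 <= t <= 1 ->
    `|x - (x + s *: (h *: delta_mx 0 k) + t *: (h *: delta_mx 0 l))| < d.
  move=> /andP[s0 s1] /andP[t0 t1].
  rewrite -addrA opprD addNKr normrN.
  apply: le_lt_trans (ler_normD _ _) _; rewrite !normrZ.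
  rewrite (ger0_norm s0) (ger0_norm t0) (gtr0_norm h0).
  have le_h r (m : 'I_n) : 0 <= r -> r <= 1 ->
      r * (h * `|delta_mx 0 m : E|) <= h.
    move=> r0 r1; rewrite mulrCA; apply: ler_piMr; first exact: ltW.
    by rewrite mulr_ile1// delta_norm.
  apply: le_lt_trans (lerD (le_h _ _ s0 s1) (le_h _ _ t0 t1)) _.
  exact: hd.
have diff2 k l : exists2 y, `|x - y| < d &
    F (x + h *: delta_mx 0 k + h *: delta_mx 0 l) - F (x + h *: delta_mx 0 k)
    - (F (x + h *: delta_mx 0 l) - F x)
    = h * (h * partial (partial F k) l y).
  have [t t01|t t01 E1] := @MVT_line R E (fun y => F (y + h *: delta_mx 0 l) - F y)
    (fun y => h * partial F k (y + h *: delta_mx 0 l) - h * partial F k y)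
    x (h *: delta_mx 0 k).
    have s0 : 0 <= (0 : R) <= 1 by rewrite lexx ler01.
    have s1 : 0 <= (1 : R) <= 1 by rewrite lexx ler01.
    apply: is_deriveB.
      apply: is_derive_translate; apply: is_derive_dirZ.
      have := near_x k l t 1 t01 s1; rewrite scale1r => /dP Ay.
      by have [_ /(_ k)[/derivableP]] := FA.1 _ Ay.
    apply: is_derive_dirZ.
    have := near_x k l t 0 t01 s0; rewrite scale0r addr0 => /dP Ay.
    by have [_ /(_ k)[/derivableP]] := FA.1 _ Ay.
  have t01' : 0 <= t <= 1 by case/andP: t01 => /ltW -> /ltW ->.
  have [s s01|s s01 E2] := @MVT_line R E (partial F k)
    (fun y => h * partial (partial F k) l y)
    (x + t *: (h *: delta_mx 0 k)) (h *: delta_mx 0 l).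
    apply: is_derive_dirZ.
    have /dP Ay := near_x k l t s t01' s01.
    by have [_ /(_ l)[/derivableP]] := FA.2 k _ Ay.
  exists (x + t *: (h *: delta_mx 0 k) + s *: (h *: delta_mx 0 l)).
    by apply: near_x => //; case/andP: s01 => /ltW -> /ltW ->.
  by rewrite -E2 mulrBr -E1.
have [y xy Ey] := diff2 j i.
have [z xz Ez] := diff2 i j.
exists y, z; split.
- by apply: lt_le_trans xy _; rewrite ge_min lexx.
- by apply: lt_le_trans xz _; rewrite ge_min lexx.
apply: (mulfI (lt0r_neq0 h0)); apply: (mulfI (lt0r_neq0 h0)).
have swap (a b c e : R) : a - b - (c - e) = a - c - (b - e) by ring.
apply: etrans (esym Ey) _; rewrite swap [x + _ + _]addrAC; exact: Ez.
Qed.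

Lemma hessE F x v w :
  hess F x v w = \sum_i \sum_j v 0 i * w 0 j * hessian F x j i.
Proof.
apply: eq_bigr => i _; rewrite mulr_sumr; apply: eq_bigr => j _.
by rewrite !mxE mulrA.
Qed.

Lemma hessNr F x v w : hess F x v (- w) = - hess F x v w.
Proof. by rewrite -sumrN; apply: eq_bigr => i _; rewrite dotNl mulrN. Qed.

End second_derivative.

(** * Convex functions of class C2 *)

Lemma near0_01 (R : realType) : \forall h \near (0 : R), 0 < h -> 0 <= h <= 1.
Proof.
near=> h => h0; rewrite ltW//=; apply: le_trans (ler_norm h) _; apply/ltW.
near: h; apply: (@nbhs0_lt R R) => //.
Unshelve. all: by end_near. Qed.

Lemma line_cvg (R : realType) (V : normedModType R) (x v : V) :
  x + h *: v @[h --> (0 : R)] --> x.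
Proof.
rewrite -[X in _ --> X]addr0 -[X in _ + X](scale0r v).
by apply: cvgD; [exact: cvg_cst|apply: cvgZr_tmp; exact: cvg_id].
Qed.

Lemma near_line (R : realType) (V : normedModType R) (A : set V) (x v : V) :
  open A -> A x -> \forall h \near (0 : R), A (x + h *: v).
Proof. by move=> oA Ax; apply: line_cvg; exact: open_nbhs_nbhs. Qed.

Record convexC2 (R : realType) (n : nat) (A : set 'rV[R]_n) (F : 'rV[R]_n -> R) :
    Prop := ConvexC2 {
  dom_open : open A ;
  dom_cvx : forall x y t, A x -> A y -> 0 <= t <= 1 ->
    A (t *: x + (1 - t) *: y) ;
  cvx_C2 : C2_on A F ;
  cvx_le : forall x y t, A x -> A y -> 0 <= t <= 1 ->
    F (t *: x + (1 - t) *: y) <= t * F x + (1 - t) * F y }.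

Section convex_C2.
Context {R : realType} {n : nat}.
Variables (A : set 'rV[R]_n) (F : 'rV[R]_n -> R).
Hypothesis cF : convexC2 A F.
Let oA := (dom_open cF).
Implicit Types x y v w : 'rV[R]_n.

(** Chord slopes at [x] bound the derivative there. *)
Lemma tangent_le x y : A x -> A y -> F x + dot (y - x) (grad F x) <= F y.
Proof.
move=> Ax Ay; rewrite -lerBrDl.
apply: (is_derive_le (C2_is_derive (y - x) oA (cvx_C2 cF) Ax)).
apply: filterS (near0_01 R) => h h01 /h01 {}h01.
have -> : x + h *: (y - x) = h *: y + (1 - h) *: x.
  by rewrite scalerBr scalerBl scale1r addrCA addrC -addrA [- _ + _]addrC.
by apply: le_trans (cvx_le cF Ay Ax h01) _; lra.
Qed.

Lemma grad_mono x y : A x -> A y ->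
  dot (y - x) (grad F x) <= dot (y - x) (grad F y).
Proof.
move=> Ax Ay; have := lerD (tangent_le Ax Ay) (tangent_le Ay Ax).
rewrite -(opprB y x) dotNl; lra.
Qed.

Lemma hess_ge0 x v : A x -> 0 <= hess F x v v.
Proof.
move=> Ax; apply: (is_derive_ge (grad_is_derive v v oA (cvx_C2 cF) Ax)).
apply: filterS (near_line v oA Ax) => h Ah h0.
have := grad_mono Ax Ah.
by rewrite [x + _]addrC addrK !dotZl mulr0 addr0 ler_pM2l// addrC.
Qed.

End convex_C2.

(** * Continuity and compactness *)

Section dot_topology.
Context {R : realType} {n : nat}.
Implicit Types (x v w c : 'rV[R]_n) (r : R).

Lemma dot_is_derive v x w : is_derive x w (dot v) (dot v w).
Proof.
apply/is_derive_epsP => e e0; near=> h.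
rewrite dotDr dotZr (_ : _ - _ = 0) ?normr0; last by ring.
by rewrite mulr_ge0// ltW.
Unshelve. all: by end_near. Qed.

Lemma dist_continuous c : continuous (fun x => `|x - c|).
Proof.
move=> x; apply: (@cvg_norm _ _ _ (nbhs x)).
have := @cvgB _ _ _ (nbhs x) _ id (cst c) x c; apply; [exact: cvg_id|exact: cvg_cst].
Qed.

Lemma compact_le_dist c r : compact [set x : 'rV[R]_n | `|x - c| <= r].
Proof.
apply: bounded_closed_compact; last first.
  exact: ((continuous_closedP _).1 (@dist_continuous c) _ (@closed_le R r)).
exists (r + `|c|); split; first exact: num_real.
move=> M rM x /= xr; apply: le_trans (ltW rM).
rewrite -[x](subrK c); apply: le_trans (ler_normD _ _) _; exact: lerD.
Qed.

Lemma compact_eq_dist c r : compact [set x : 'rV[R]_n | `|x - c| = r].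
Proof.
apply: subclosed_compact (@compact_le_dist c r) _ => [|x /= ->//].
exact: ((continuous_closedP _).1 (@dist_continuous c) _ (@closed_eq R r)).
Qed.

Lemma near_dist_lt c r x : `|x - c| < r -> \forall y \near x, `|y - c| < r.
Proof. exact: cvgr_lt (@dist_continuous c x) _. Qed.

Lemma open_lt_dist c r : open [set x : 'rV[R]_n | `|x - c| < r].
Proof.
apply: (@open_comp _ _ (fun x : 'rV[R]_n => `|x - c|) [set y | y < r]).
  by move=> x _; have := @dist_continuous c x; exact.
exact: open_lt.
Qed.

Lemma dot_shift_continuous v p : continuous (fun x => dot v (x - p)).
Proof.
move=> x; have -> : (fun y => dot v (y - p)) = dot v - cst (dot v p).
  by apply/funext => y; rewrite dotBr.
have := @continuousB _ _ _ (dot v) (cst (dot v p)) x; apply.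
  exact: dot_continuous.
exact: cst_continuous.
Qed.

End dot_topology.

Section compactness.
Context {R : realType} {T : topologicalType}.

(** A multiple of [phi] compensates the negative values of [psi]: near a zero of
[phi] none is needed, elsewhere a large one suffices, and compactness makes the
choice uniform. *)
Lemma compact_coef (K : set T) (phi psi : T -> R) : compact K ->
  (forall x, K x -> {for x, continuous phi}) ->
  (forall x, K x -> {for x, continuous psi}) ->
  (forall x, K x -> 0 <= phi x) ->
  (forall x, K x -> phi x = 0 -> 0 < psi x) ->
  exists N, forall x, K x -> 0 < N * phi x + psi x.
Proof.
move=> /compact_near_coveringP/near_covering_withinP cK cphi cpsi phi0 psi0.
have H : \forall N \near +oo, forall x, K x -> 0 < N * phi x + psi x.
  have := cK R (+oo)%R (fun N x => 0 < N * phi x + psi x) _; apply => x Kx.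
  have [px0|px0] := eqVneq (phi x) 0.
    have cx := cvgr_gt _ (cpsi _ Kx) _ (psi0 _ Kx px0).
    near=> y N => Ky.
    have N0 : 0 <= N by near: N; exact: nbhs_pinfty_ge.
    have py : 0 < psi y by near: y; exact: cx.
    by apply: ltr_wpDl => //; apply: mulr_ge0 => //; exact: phi0.
  have px : 0 < phi x by rewrite lt0r px0 phi0.
  have px2 : phi x / 2 < phi x by lra.
  have c1 := cvgr_gt _ (cphi _ Kx) _ px2.
  have psi1 : psi x - 1 < psi x by lra.
  have c2 := cvgr_gt _ (cpsi _ Kx) _ psi1.
  near=> y N => Ky.
  have y1 : phi x / 2 < phi y by near: y; exact: c1.
  have y2 : psi x - 1 < psi y by near: y; exact: c2.
  have N0 : 0 <= N by near: N; exact: nbhs_pinfty_ge.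
  have NP : (`|psi x| + 1) / (phi x / 2) <= N.
    by near: N; apply: nbhs_pinfty_ge; exact: num_real.
  have {NP} : `|psi x| + 1 <= N * (phi x / 2) by rewrite -ler_pdivrMr ?divr_gt0.
  have := ler_wpM2l N0 (ltW y1); have := ler_norm (- psi x); rewrite normrN.
  move: y2; move: (N * phi y) (N * (phi x / 2)) `|psi x| (psi x) (psi y) => *; lra.
by have [N [_ /(_ (N + 1))]] := H; rewrite ltrDl ltr01 => /(_ isT) NP; exists (N + 1).
Unshelve. all: by end_near. Qed.

Lemma compact_pos (K : set T) (psi : T -> R) : compact K ->
  (forall x, K x -> {for x, continuous psi}) ->
  (forall x, K x -> 0 < psi x) ->
  exists2 m, 0 < m & forall x, K x -> m < psi x.
Proof.
move=> cK cpsi psi0.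
have [N NP] : exists N, forall x, K x -> 0 < N * psi x + (-1).
  apply: (@compact_coef K psi (fun=> -1)) => // x Kx; first exact: cvg_cst.
  - exact/ltW/psi0.
  - by move=> px0; have := psi0 _ Kx; rewrite px0 ltxx.
exists (`|N| + 1)^-1; first by rewrite invr_gt0 ltr_wpDl.
move=> x Kx; rewrite -[ltLHS]mul1r ltr_pdivrMr ?ltr_wpDl//.
have := NP x Kx; rewrite subr_gt0 => /lt_le_trans; apply.
rewrite mulrC ler_wpM2l ?(ltW (psi0 _ _))//.
by apply: le_trans (ler_norm _) _; rewrite lerDl.
Qed.

End compactness.

(** * The gap between a function and its tangent plane *)

Local Opaque partial.

Section grad_near.
Context {R : realType} {n : nat}.
Notation E := 'rV[R]_n.
Implicit Types (F : E -> R) (x y v : E) (A : set E).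

Lemma near_grad A F x eps : C1_on A F -> A x -> 0 < eps ->
  \forall y \near x, `|grad F y - grad F x| < eps.
Proof.
move=> FA Ax eps0.
have : \forall y \near x, forall i, `|partial F i y - partial F i x| < eps.
  near=> y; near: y; apply: filter_forall => i.
  have [_ /(_ i)[_ /cvgrPdist_lt/(_ _ eps0)]] := FA _ Ax.
  by apply: filterS => y; rewrite [ltLHS]distrC; exact.
apply: filterS => y Fy; rewrite /Num.norm /= mx_normrE.
by apply/bigmax_ltP; split=> // -[i j] _ /=; rewrite (ord1 i) !mxE.
Unshelve. all: by end_near. Qed.

Lemma hessian_eq0_of_grad A F x c : open A -> C2_on A F -> A x ->
  (\forall y \near x, grad F y = c) -> hessian F x = 0.
Proof.
move=> oA FA Ax Fc; apply/matrixP => i j; rewrite !mxE.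
have d0 : is_derive x (delta_mx 0 i) (partial F j) 0.
  apply/is_derive_epsP => e e0.
  have : \forall h \near (0 : R), grad F (x + h *: delta_mx 0 i) = c.
    by have := @line_cvg R E x (delta_mx 0 i) _ Fc; exact.
  apply: filterS => h Fh.
  have gradE y : partial F j y = grad F y 0 j by rewrite mxE.
  rewrite !gradE Fh (nbhs_singleton Fc) mulr0 subrr subr0 normr0.
  by rewrite mulr_ge0// ltW.
exact: (@derive_val _ _ _ _ _ _ _ d0).
Qed.

Lemma hessian_continuous A F x i j : C2_on A F -> A x ->
  {for x, continuous (fun y => hessian F y i j)}.
Proof.
move=> FA Ax.
rewrite (_ : (fun y => _) = partial (partial F j) i).
  by have [_ /(_ i)[]] := FA.2 j _ Ax.
by apply/funext => y; rewrite mxE.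
Qed.

Lemma grad_const_of_hessian A F x : open A -> C2_on A F -> A x ->
  (\forall y \near x, hessian F y = 0) -> \forall y \near x, grad F y = grad F x.
Proof.
move=> oA FA Ax H0; have nA := open_nbhs_nbhs (conj oA Ax).
have [d /= d0] := (nbhs_ballP _ _).1 (filterI nA H0).
rewrite -ball_normE => dP; apply/nbhs_ballP; exists d => // y.
rewrite -ball_normE /= => xy.
suff eq_dot e : dot e (grad F y) = dot e (grad F x).
  by apply/eqP; rewrite -subr_eq0 -dot_eq0 dotBr eq_dot subrr.
have [t t01|t t01] := @MVT_line R E (fun z => dot e (grad F z))
  (fun z => hess F z e (y - x)) x (y - x).
  have /dP[Az _] : `|x - (x + t *: (y - x))| < d.
    case/andP: t01 => t0 t1.
    rewrite opprD addNKr normrN normrZ ger0_norm//; apply: le_lt_trans xy.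
    by rewrite distrC ler_piMl.
  exact: grad_is_derive oA FA Az.
have /dP[Az Hz] : `|x - (x + t *: (y - x))| < d.
  case/andP: t01 => t0 t1.
  rewrite opprD addNKr normrN normrZ gtr0_norm//; apply: le_lt_trans xy.
  by rewrite distrC ler_piMl// ltW.
rewrite [x + (y - x)]addrC subrK hessE Hz => /eqP; rewrite subr_eq => /eqP ->.
rewrite big1 ?add0r// => i _; rewrite big1// => j _; by rewrite !mxE mulr0.
Qed.

Definition gap F p x : R := F x - F p - dot (x - p) (grad F p).

Lemma gap_id F p : gap F p p = 0.
Proof. by rewrite /gap !subrr dot0l subrr. Qed.

Lemma gap_continuous A F p x : C1_on A F -> A x -> {for x, continuous (gap F p)}.
Proof.
move=> FA Ax.
have d_cont : {for x, continuous (fun y => dot (grad F p) (y - p))}.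
  have -> : (fun y => dot (grad F p) (y - p))
      = dot (grad F p) - cst (dot (grad F p) p).
    by apply/funext => y; rewrite dotBr.
  by apply: continuousB; [exact: dot_continuous|exact: cst_continuous].
have -> : gap F p = F - cst (F p) - (fun y => dot (grad F p) (y - p)).
  by apply/funext => y; rewrite /gap dotC.
apply: continuousB => //; apply: continuousB; last exact: cst_continuous.
by have [] := FA _ Ax.
Qed.

Lemma gap_is_derive A F p x v : open A -> C2_on A F -> A x ->
  is_derive x v (gap F p) (dot v (grad F x) - dot v (grad F p)).
Proof.
move=> oA FA Ax; have dF := C2_is_derive v oA FA Ax.
have dn := dot_is_derive (grad F p) x v.
have -> : gap F p = F - dot (grad F p) + cst (dot (grad F p) p - F p).
  by apply/funext => y; rewrite /gap !fctE dotBl !(dotC _ (grad F p)); ring.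
rewrite (dotC v (grad F p)) -[X in is_derive _ _ _ X]addr0.
exact: is_deriveD (is_deriveB dF dn) _.
Qed.

Section convex.
Variables (A : set E) (F : E -> R).
Hypothesis cF : convexC2 A F.

Lemma gap_ge0 p x : A p -> A x -> 0 <= gap F p x.
Proof. by move=> Ap Ax; have := tangent_le cF Ap Ax; rewrite /gap; lra. Qed.

(** Subtracting an affine function from [F] subtracts it from its tangent planes
too. *)
Lemma gap_tangent p x y : A x -> A y ->
  gap F p x + dot (y - x) (grad F x - grad F p) <= gap F p y.
Proof.
move=> Ax Ay; have := tangent_le cF Ax Ay; rewrite /gap dotBr !dotBl; lra.
Qed.

Lemma gap_convex p x y t : A x -> A y -> 0 <= t <= 1 ->
  gap F p (t *: x + (1 - t) *: y) <= t * gap F p x + (1 - t) * gap F p y.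
Proof.
move=> Ax Ay t01; have := cvx_le cF Ax Ay t01.
rewrite /gap !dotBl dotDl !dotZl; lra.
Qed.

(** A function equal to an affine one near [p] has constant gradient there. *)
Lemma hessian_eq0_of_gap p : A p -> (\forall x \near p, gap F p x = 0) ->
  \forall x \near p, hessian F x = 0.
Proof.
move=> Ap g0.
have oA := dom_open cF.
have gradc : \forall y \near p, grad F y = grad F p.
  have nA := open_nbhs_nbhs (conj oA Ap).
  have := nbhs_interior g0; move: nA; apply: filterS2 => y Ay g0y.
  apply/rowP => i; rewrite [LHS]mxE -(dot_delta i (grad F p)).
  have d0 : is_derive y (delta_mx 0 i) F (dot (delta_mx 0 i) (grad F p)).
    apply/is_derive_epsP => e e0.
    have : \forall h \near (0 : R), gap F p (y + h *: delta_mx 0 i) = 0.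
      by have := @line_cvg R E y (delta_mx 0 i) _ g0y; exact.
    apply: filterS => h gh.
    have := nbhs_singleton g0y; move: gh.
    rewrite /gap !dotBl dotDl dotZl => gh gy.
    set z := (X in `|X|); have -> : z = 0 by rewrite /z; lra.
    by rewrite normr0 mulr_ge0// ltW.
  exact: (@derive_val _ _ _ _ _ _ _ d0).
have nA := open_nbhs_nbhs (conj oA Ap).
have := nbhs_interior gradc; move: nA; apply: filterS2 => x Ax.
exact: hessian_eq0_of_grad oA (cvx_C2 cF) Ax.
Qed.

(** At a zero the nonnegative gap is minimal, so its gradient vanishes. *)
Lemma grad_eq_of_gap0 p y : A p -> A y -> gap F p y = 0 -> grad F y = grad F p.
Proof.
move=> Ap Ay gy; apply/eqP; rewrite -subr_eq0 -dot_eq0 eq_le dot_ge0 andbT.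
set d := grad F y - grad F p.
have dg := gap_is_derive p (- d) (dom_open cF) (cvx_C2 cF) Ay.
rewrite -oppr_ge0 -dotNl {2}/d dotBr; apply: (is_derive_ge dg).
apply: filterS (near_line (- d) (dom_open cF) Ay) => h Ah _.
by rewrite gy mulr0 addr0 gap_ge0.
Qed.

(** The tangent planes at [p] and [y] are then the same plane. *)
Lemma gap_shift p y x : gap F p y = 0 -> grad F y = grad F p -> gap F y x = gap F p x.
Proof. by rewrite /gap => + ->; rewrite !dotBl; lra. Qed.

(** By convexity the zero set of the gap at [p] contains the cone with apex [z]
over a neighborhood of [y] where [F] is affine, and this cone is a neighborhood
of [p]. *)
Lemma flat_spreads p y z t : A p -> A y -> A z -> 0 < t <= 1 ->
  p = t *: y + (1 - t) *: z -> gap F p y = 0 -> gap F p z = 0 ->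
  (\forall x \near y, hessian F x = 0) -> \forall x \near p, hessian F x = 0.
Proof.
move=> Ap Ay Az /andP[t0 t1] pE gy gz Hy.
have oA := dom_open cF; apply: hessian_eq0_of_gap => //.
have gradc := grad_const_of_hessian oA (cvx_C2 cF) Ay Hy.
have nA := open_nbhs_nbhs (conj oA Ay).
have gapy : \forall x \near y, A x /\ gap F p x = 0.
  move: nA gradc; apply: filterS2 => x Ax gx; split=> //.
  apply/eqP; rewrite eq_le gap_ge0// andbT.
  have := gap_tangent p Ax Ay.
  by rewrite gx (grad_eq_of_gap0 Ap Ay gy) subrr dotC dot0l addr0 gy.
have [d /= d0] := (nbhs_ballP _ _).1 gapy; rewrite -ball_normE => dP.
have near_p : \forall x \near p,
    A (y + t^-1 *: (x - p)) /\ gap F p (y + t^-1 *: (x - p)) = 0.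
  have td : `|p - p| < t * d by rewrite subrr normr0 mulr_gt0.
  apply: filterS (near_dist_lt td) => x xp; apply: dP; rewrite /= opprD addNKr.
  by rewrite normrN normrZ gtr0_norm ?invr_gt0// ltr_pdivrMl.
move: near_p (open_nbhs_nbhs (conj oA Ap)); apply: filterS2 => x [Ax' gx'] Ax.
have xE : x = t *: (y + t^-1 *: (x - p)) + (1 - t) *: z.
  by rewrite scalerDr scalerA divff ?gt_eqF// scale1r addrAC -pE addrC subrK.
apply/eqP; rewrite eq_le gap_ge0// andbT {1}xE.
have t01 : 0 <= t <= 1 by rewrite ltW.
by apply: le_trans (gap_convex p Ax' Az t01) _; rewrite gx' gz !mulr0 addr0.
Qed.

End convex.

End grad_near.

(** * Plane vectors and forms *)

Section plane.
Context {R : realType}.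
Notation E := 'rV[R]_2.
Implicit Types (F : E -> R) (x y v w e : E) (A : set E).

Lemma sum2 (G : 'I_2 -> R) : \sum_i G i = G 0 + G 1.
Proof.
rewrite big_ord_recl big_ord1; congr (_ + G _); exact/val_inj.
Qed.

Lemma rV2P x y : x 0 0 = y 0 0 -> x 0 1 = y 0 1 -> x = y.
Proof.
move=> x0 x1; apply/rowP => -[[|[|//]] i].
  by rewrite (_ : Ordinal _ = 0)//; exact/val_inj.
by rewrite (_ : Ordinal _ = 1)//; exact/val_inj.
Qed.

Lemma dot2E v w : dot v w = v 0 0 * w 0 0 + v 0 1 * w 0 1.
Proof. exact: sum2. Qed.

Lemma hessianC A F x : open A -> C2_on A F -> A x ->
  hessian F x 1 0 = hessian F x 0 1.
Proof. by move=> oA FA Ax; rewrite !mxE; exact: partialC oA FA Ax. Qed.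

Lemma hess2E A F x v w : open A -> C2_on A F -> A x ->
  hess F x v w = v 0 0 * w 0 0 * hessian F x 0 0
    + (v 0 0 * w 0 1 + v 0 1 * w 0 0) * hessian F x 0 1
    + v 0 1 * w 0 1 * hessian F x 1 1.
Proof.
move=> oA FA Ax; rewrite hessE sum2 !sum2.
rewrite (hessianC oA FA Ax); ring.
Qed.

Definition perp e : E := \row_i (if i == 0 then - e 0 1 else e 0 0).

Lemma dot_perp e : dot (perp e) e = 0.
Proof. by rewrite dot2E !mxE /=; ring. Qed.

Lemma perp_eq0 e : perp e = 0 -> e = 0.
Proof.
move=> /rowP pe; apply: rV2P; rewrite !mxE.
  by have := pe 1; rewrite !mxE.
by apply/eqP; rewrite -oppr_eq0; have := pe 0; rewrite !mxE /= => ->.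
Qed.

Lemma dot_perp_eq0 e y : e != 0 -> dot (perp e) y = 0 -> exists t, y = t *: e.
Proof.
rewrite -dot_eq0 dot2E => e0; rewrite dot2E !mxE /= => ey.
exists ((y 0 0 * e 0 0 + y 0 1 * e 0 1) / (e 0 0 * e 0 0 + e 0 1 * e 0 1)).
have y01 : e 0 0 * y 0 1 = e 0 1 * y 0 0 by lra.
apply: rV2P; rewrite mxE; apply: (mulIf e0); rewrite mulrAC divfK//.
  rewrite [RHS](_ : _ = y 0 0 * e 0 0 ^+ 2 + e 0 1 * (e 0 0 * y 0 1)); last ring.
  by rewrite y01; ring.
rewrite [RHS](_ : _ = y 0 1 * e 0 1 ^+ 2 + e 0 0 * (e 0 1 * y 0 0)); last ring.
by rewrite -y01; ring.
Qed.

End plane.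

Lemma hessian_psd (R : realType) (A : set 'rV[R]_2) F x :
  convexC2 A F -> A x ->
  [/\ 0 <= hessian F x 0 0, 0 <= hessian F x 1 1 &
      hessian F x 0 1 ^+ 2 <= hessian F x 0 0 * hessian F x 1 1].
Proof.
move=> cF Ax; pose vec (s t : R) : 'rV[R]_2 := \row_i (if i == 0 then s else t).
have vecE s t : vec s t 0 0 = s /\ vec s t 0 1 = t by rewrite !mxE.
have q s t : 0 <= s * s * hessian F x 0 0 + 2 * (s * t) * hessian F x 0 1
                  + t * t * hessian F x 1 1.
  have := hess_ge0 cF (vec s t) Ax.
  rewrite (hess2E _ _ (dom_open cF) (cvx_C2 cF) Ax) (vecE s t).1 (vecE s t).2.
  by rewrite [t * s]mulrC [2 * _](mulr_natl _ 2) mulr2n.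
move: q; move: (hessian F x 0 0) (hessian F x 0 1) (hessian F x 1 1) => a b c q.
have a0 : 0 <= a by have := q 1 0; lra.
have c0 : 0 <= c by have := q 0 1; lra.
split=> //; have [a_eq0|an0] := eqVneq a 0.
  have [->|bn0] := eqVneq b 0; first by rewrite expr0n /= mulr_ge0.
  have := q (- (c + 1) / (2 * b)) 1; rewrite a_eq0.
  have -> : 2 * (- (c + 1) / (2 * b) * 1) * b = - (c + 1) by field.
  lra.
have a_gt0 : 0 < a by rewrite lt0r an0.
have := q (- b) a; rewrite -(ler_pM2l a_gt0) => qq.
by rewrite -(ler_pM2l a_gt0); rewrite -(ler_pM2l a_gt0); nra.
Qed.

(** The Cauchy-Schwarz inequalities give [(b b')^2 <= (a c') (c a')], while
[b b'] is the arithmetic mean of [a c'] and [c a']; so both factors are equal. *)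
Lemma mixed_disc_parallel (R : realFieldType) (a b c a' b' c' : R) :
  0 <= a -> 0 <= c -> 0 <= a' -> 0 <= c' ->
  b ^+ 2 <= a * c -> b' ^+ 2 <= a' * c' ->
  a * c' + c * a' = 2 * (b * b') ->
  [/\ a * b' = b * a', b * c' = c * b', a * c' = c * a' & a * c' = b * b'].
Proof.
move=> a0 c0 a'0 c'0 bac bac' mix.
have acac : (b * b') ^+ 2 <= (a * c') * (c * a').
  rewrite exprMn (_ : a * c' * (c * a') = (a * c) * (a' * c')); last ring.
  by apply: ler_pM => //; exact: sqr_ge0.
have eq0 : (a * c' - c * a') ^+ 2 = 0.
  apply/eqP; rewrite eq_le sqr_ge0 andbT.
  rewrite (_ : _ ^+ 2 = (a * c' + c * a') ^+ 2 - 4 * ((a * c') * (c * a'))); last ring.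
  by rewrite mix exprMn; lra.
have ac : a * c' = c * a'.
  by apply/eqP; rewrite -subr_eq0 -sqrf_eq0 eq0.
have abb : a * c' = b * b' by lra.
split=> //.
  apply/eqP; rewrite -subr_eq0 -sqrf_eq0 eq_le sqr_ge0 andbT.
  have := ler_wpM2l (sqr_ge0 a) bac'; have := ler_wpM2l (sqr_ge0 a') bac.
  have -> : a' ^+ 2 * (a * c) = (a * a') * (c * a') by ring.
  have -> : a ^+ 2 * (a' * c') = (a * a') * (a * c') by ring.
  rewrite -ac abb; lra.
apply/eqP; rewrite -subr_eq0 -sqrf_eq0 eq_le sqr_ge0 andbT.
have := ler_wpM2l (sqr_ge0 c) bac'; have := ler_wpM2l (sqr_ge0 c') bac.
have -> : c' ^+ 2 * (a * c) = (c * c') * (a * c') by ring.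
have -> : c ^+ 2 * (a' * c') = (c * c') * (c * a') by ring.
rewrite -ac abb; lra.
Qed.

Lemma mixed_discriminant_sym (R : numFieldType) (M N : 'M[R]_2) :
  M 1 0 = M 0 1 -> N 1 0 = N 0 1 ->
  2 * mixed_discriminant M N =
  M 0 0 * N 1 1 + M 1 1 * N 0 0 - 2 * (M 0 1 * N 0 1).
Proof.
by move=> M10 N10; rewrite /mixed_discriminant !det_mx22 !mxE M10 N10; field.
Qed.

Lemma parallel_forms (R : comNzRingType) (a b c a' b' c' p q s t : R) :
  a * b' = b * a' -> b * c' = c * b' -> a * c' = c * a' ->
  (p * p * a' + (p * q + q * p) * b' + q * q * c')
  * (p * s * a + (p * t + q * s) * b + q * t * c) =
  (p * s * a' + (p * t + q * s) * b' + q * t * c')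
  * (p * p * a + (p * q + q * p) * b + q * q * c).
Proof.
move=> h1 h2 h3; apply/eqP; rewrite -subr_eq0; apply/eqP.
transitivity ((p * t - q * s) * (p ^+ 2 * (b * a' - a * b')
  + p * q * (c * a' - a * c') + q ^+ 2 * (c * b' - b * c'))); first ring.
by rewrite h1 h2 h3 !subrr; ring.
Qed.

Lemma cauchy_schwarz_form (R : realFieldType) (a b c p q s t : R) :
  b ^+ 2 <= a * c ->
  (p * s * a + (p * t + q * s) * b + q * t * c) ^+ 2 <=
  (p * p * a + (p * q + q * p) * b + q * q * c)
  * (s * s * a + (s * t + t * s) * b + t * t * c).
Proof.
move=> b0; rewrite -subr_ge0.
rewrite (_ : _ - _ = (p * t - q * s) ^+ 2 * (a * c - b ^+ 2)); last ring.
by rewrite mulr_ge0 ?sqr_ge0// subr_ge0.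
Qed.

Lemma hess_eq0 (R : realType) (A : set 'rV[R]_2) F x e w :
  convexC2 A F -> A x -> hess F x e e = 0 -> hess F x e w = 0.
Proof.
move=> cF Ox ee; have [_ _ b0] := hessian_psd cF Ox.
apply/eqP; rewrite -sqrf_eq0 eq_le sqr_ge0 andbT.
have : hess F x e w ^+ 2 <= hess F x e e * hess F x w w; last by rewrite ee mul0r.
rewrite !(hess2E _ _ (dom_open cF) (cvx_C2 cF) Ox).
exact: cauchy_schwarz_form b0.
Qed.

Lemma det_sym (R : comNzRingType) (M : 'M[R]_2) : M 1 0 = M 0 1 ->
  \det M = M 0 0 * M 1 1 - M 0 1 ^+ 2.
Proof. by move=> M10; rewrite det_mx22 M10 expr2. Qed.

(** By the parallelism relations, multiplying the second form by the determinant
of the first one gives zero. *)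
Lemma pos_det_eq0 (R : realFieldType) (a b c a' b' c' : R) :
  a * b' = b * a' -> b * c' = c * b' -> a * c' = c * a' -> a * c' = b * b' ->
  0 < a * c - b ^+ 2 -> [/\ a' = 0, b' = 0 & c' = 0].
Proof.
move=> h1 h2 h3 h4 /lt0r_neq0 d0.
have key s t : (a * c - b ^+ 2) * t = s -> s = 0 -> t = 0.
  by move=> <- /eqP; rewrite mulf_eq0 (negbTE d0) => /eqP.
split.
- apply: (key (a * (c * a') - b * (b * a'))); first ring.
  by rewrite -h1 -h3 h4; ring.
- apply: (key (c * (a * b') - b * (b * b'))); first ring.
  by rewrite h1 -h4 h3; ring.
- apply: (key (c * (a * c') - b * (b * c'))); first ring.
  by rewrite h2 h4; ring.
Qed.

(** Evaluated at the vector [(c + c', - (b + b'))], the sum of the forms is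
[c + c'] times its determinant, and the mixed terms of the determinant cancel. *)
Lemma pos_def_forms (R : realFieldType) (a b c a' b' c' : R) :
  a * c' = c * a' -> a * c' = b * b' ->
  (forall s t, ~~ ((s == 0) && (t == 0)) ->
    0 < s * s * a + (s * t + t * s) * b + t * t * c
      + (s * s * a' + (s * t + t * s) * b' + t * t * c')) ->
  0 < a * c - b ^+ 2 \/ 0 < a' * c' - b' ^+ 2.
Proof.
move=> h3 h4 pd.
have cc0 : 0 < c + c'.
  have := pd 0 1; rewrite eqxx oner_eq0 => /(_ isT).
  by apply: etrans; congr (_ < _); ring.
have : 0 < (c + c') * ((a * c - b ^+ 2) + (a' * c' - b' ^+ 2)
    + (a * c' + c * a' - 2 * (b * b'))).
  rewrite (_ : _ * _ = (c + c') * (c + c') * a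
    + ((c + c') * (- (b + b')) + (- (b + b')) * (c + c')) * b
    + (- (b + b')) * (- (b + b')) * c + ((c + c') * (c + c') * a'
    + ((c + c') * (- (b + b')) + (- (b + b')) * (c + c')) * b'
    + (- (b + b')) * (- (b + b')) * c')); last ring.
  by apply: pd; rewrite (gt_eqF cc0).
rewrite pmulr_rgt0// -h3 -h4 => S0.
have [|d0] := ltP 0 (a * c - b ^+ 2); [by left|right; lra].
Qed.

(** * Pairs with vanishing mixed discriminant *)

Local Opaque hessian determinant.

Record degenerate_pair (R : realType) (Omega D : set 'rV[R]_2)
    (f g : 'rV[R]_2 -> R) : Prop := DegeneratePair {
  pair_l : convexC2 Omega f ;
  pair_r : convexC2 Omega g ;
  pair_open : open D ;
  pair_sub : D `<=` Omega ;
  pair_mixed : forall x, D x ->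
    mixed_discriminant (hessian f x) (hessian g x) = 0 }.

Lemma degenerate_pairC (R : realType) (Omega D : set 'rV[R]_2) f g :
  degenerate_pair Omega D f g -> degenerate_pair Omega D g f.
Proof.
case=> cf cg oD DO fg; apply: (DegeneratePair cg cf oD DO) => x Dx.
by rewrite mixed_discriminantC; exact: fg.
Qed.

Section degenerate_pair.
Context {R : realType}.
Notation E := 'rV[R]_2.
Variables (Omega D : set E) (f g : E -> R).
Hypothesis P : degenerate_pair Omega D f g.
Implicit Types (x y v w e c : E) (r : R).

Let oO := dom_open (pair_l P).
Let fC2 := cvx_C2 (pair_l P).
Let gC2 := cvx_C2 (pair_r P).

Definition dsum v x : R := dot v (grad f x) + dot v (grad g x).

Lemma pair_coef x : D x ->
  [/\ hessian f x 0 0 * hessian g x 0 1 = hessian f x 0 1 * hessian g x 0 0,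
      hessian f x 0 1 * hessian g x 1 1 = hessian f x 1 1 * hessian g x 0 1,
      hessian f x 0 0 * hessian g x 1 1 = hessian f x 1 1 * hessian g x 0 0 &
      hessian f x 0 0 * hessian g x 1 1 = hessian f x 0 1 * hessian g x 0 1].
Proof.
move=> Dx; have Ox := pair_sub P Dx.
have [a0 c0 b0] := hessian_psd (pair_l P) Ox.
have [a'0 c'0 b'0] := hessian_psd (pair_r P) Ox.
apply: (mixed_disc_parallel a0 c0 a'0 c'0 b0 b'0).
have := mixed_discriminant_sym (hessianC oO fC2 Ox) (hessianC oO gC2 Ox).
rewrite (pair_mixed P Dx) mulr0 => mix.
by apply/eqP; rewrite -subr_eq0 -mix.
Qed.

(** The vectors obtained by applying the two Hessians to [e] are parallel. *)
Lemma pair_parallel x e w : D x ->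
  hess g x e e * hess f x e w = hess g x e w * hess f x e e.
Proof.
move=> Dx; have Ox := pair_sub P Dx; have [h1 h2 h3 _] := pair_coef Dx.
rewrite !(hess2E _ _ oO fC2 Ox) !(hess2E _ _ oO gC2 Ox).
exact: parallel_forms h1 h2 h3.
Qed.

Lemma dsum_is_derive x v w : D x ->
  is_derive x w (dsum v) (hess f x v w + hess g x v w).
Proof.
by move=> /(pair_sub P) Ox; apply: is_deriveD; apply: grad_is_derive Ox.
Qed.

Lemma dsum_continuous x v : D x -> {for x, continuous (dsum v)}.
Proof.
move=> /(pair_sub P) Ox.
exact: continuousD (grad_continuous fC2.1 Ox) (grad_continuous gC2.1 Ox).
Qed.

(** * Level sets of the directional derivatives *)

(** Both directional derivatives are monotone along a line of direction [e], so
both stay constant if their sum does. *)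
Lemma grad_eq_on_chord x y e t : Omega x -> Omega y -> y = x + t *: e ->
  dsum e y = dsum e x -> dot e (grad g y) = dot e (grad g x).
Proof.
move=> Ox Oy yE eq_sum; have yx : y - x = t *: e by rewrite yE addrC addKr.
have := grad_mono (pair_l P) Ox Oy; have := grad_mono (pair_r P) Ox Oy.
rewrite yx !dotZl; have [t0|t0] := eqVneq t 0.
  by rewrite yE t0 scale0r addr0.
move: eq_sum; rewrite /dsum.
move: (dot e (grad f y)) (dot e (grad g y)) (dot e (grad f x)) (dot e (grad g x)).
move=> a b a' b' sumE hb ha; apply/eqP; rewrite -subr_eq0 -(mulrI_eq0 _ (mulfI t0)).
have aE : a = a' + b' - b by lra.
move: ha; rewrite aE => ha; rewrite eq_le; apply/andP; split; lra.
Qed.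

(** Maximum principle. Let V be the deviation of the derivative of [f + g] along
[e] from its common value at [p] and [q], and s the coordinate transversal to
[e], equal to 0 at [p] and to 1 at [q]. If the conclusion failed, then for large
N and small eta > 0 the function [d_e g - N V^2 + eta s] on the part [0 <= s <= 1]
of the ball would exceed, at [p], all its values at [s = 1] and on the sphere.
Its maximum would then be a point where it is critical along [e] and not
increasing along [q - p]. But the gradients of [d_e g] and V are parallel, so
being critical along [e] makes [d_e g - N V^2] critical in all directions, and
eta s increases along [q - p]. *)
Lemma grad_le_of_strip c r p q e : (forall x, `|x - c| <= r -> D x) ->
  `|p - c| <= r -> `|q - c| <= r -> dsum e q = dsum e p ->
  (forall x s t, `|x - c| = r -> 0 <= s <= 1 -> x = p + s *: (q - p) + t *: e ->
     dsum e x <> dsum e p) ->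
  dot e (grad g p) <= dot e (grad g q).
Proof.
move=> CD Cp Cq eq_pq bdry.
have CO x : `|x - c| <= r -> Omega x by move=> /CD/(pair_sub P).
have [->|e0] := eqVneq e 0; first by rewrite !dot0l.
pose sigma := dot (perp e) (q - p).
(* [p] and [q] on one line of direction [e]: no strip between them. *)
have [sig0|sig0] := eqVneq sigma 0.
  have [t qpE] := dot_perp_eq0 e0 sig0.
  rewrite le_eqVlt eq_sym; apply/orP; left; apply/eqP.
  apply: (grad_eq_on_chord (CO _ Cp) (CO _ Cq) (t := t)) => //.
  by rewrite -qpE addrC subrK.
rewrite leNgt; apply/negP => gqp.
pose nu := sigma^-1 *: perp e.
have nu_e : dot nu e = 0 by rewrite dotZl dot_perp mulr0.
have nu_qp : dot nu (q - p) = 1 by rewrite dotZl mulVf.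
pose s x := dot nu x - dot nu p.
have sp : s p = 0 by rewrite /s subrr.
have sq : s q = 1 by rewrite /s -dotBr.
have s_cont : continuous s.
  move=> x; apply: (@continuousB _ _ _ (dot nu) (cst (dot nu p))).
    exact: dot_continuous.
  exact: cst_continuous.
have chord x : exists t, x = p + s x *: (q - p) + t *: e.
  have /(dot_perp_eq0 e0)[t xE] : dot (perp e) (x - p - s x *: (q - p)) = 0.
    rewrite !dotBr dotZr -dotBr -/sigma /s !dotZl.
    by rewrite -mulrBr -!dotBr mulrAC mulVf// mul1r subrr.
  by exists t; rewrite -xE -[x - p - _]addrA -opprD [RHS]addrC subrK.
pose K := [set x | `|x - c| <= r] `&` s @^-1` [set t | 0 <= t <= 1].
have cl01 : closed [set t : R | 0 <= t <= 1].
  rewrite (_ : mkset _ = [set t | 0 <= t] `&` [set t | t <= 1]).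
    by apply: closedI; [exact: closed_ge|exact: closed_le].
  by apply/seteqP; split=> t /= => [/andP[]|[-> ->]].
have cK : compact K.
  apply: compact_closedI; first exact: compact_le_dist.
  exact: ((continuous_closedP _).1 s_cont).
pose B := K `&` ([set x | `|x - c| = r] `|` s @^-1` [set t | t = 1]).
have cB : compact B.
  apply: compact_closedI => //; apply: closedU.
    exact: ((continuous_closedP _).1 (@dist_continuous _ _ c) _ (@closed_eq _ r)).
  exact: ((continuous_closedP _).1 s_cont _ (@closed_eq _ 1)).
pose dsum_e := dsum e; pose V x := dsum_e x - dsum e p.
pose eta := (dot e (grad g p) - dot e (grad g q)) / 2.
have eta0 : 0 < eta by rewrite divr_gt0// subr_gt0.
have V_cont x : D x -> {for x, continuous V}.
  move=> Dx; apply: (@continuousB _ _ _ dsum_e (cst (dsum e p))).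
    by have := dsum_continuous Dx; exact.
  exact: cst_continuous.
have h_cont x : D x -> {for x, continuous (fun y => dot e (grad g y))}.
  by move=> /(pair_sub P) Ox; have := grad_continuous gC2.1 Ox; exact.
have KD x : K x -> D x by case=> /CD.
(* On [B] the penalty wins: V can only vanish there at [s = 1], where [d_e g] is
   then its value at [q], and [eta] is half the assumed difference. *)
have [N NP] : exists N, forall x, B x ->
    0 < N * (V x * V x) + (dot e (grad g p) - dot e (grad g x) - eta * s x).
  apply: compact_coef => //.
  - by move=> x [/KD Dx _]; apply: continuousM; exact: V_cont.
  - move=> x [/KD Dx _]; apply: continuousB.
      apply: continuousB; [exact: cst_continuous|exact: h_cont].
    by apply: continuousM; [exact: cst_continuous|exact: s_cont].
  - by move=> x _; rewrite -expr2 sqr_ge0.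
  move=> x [[Cx s01] Bx] /eqP; rewrite mulf_eq0 orbb subr_eq0 => /eqP Vx.
  have [t xE] := chord x.
  case: Bx => [xr|s1]; first by case: (bdry _ _ _ xr s01 xE).
  have -> : dot e (grad g x) = dot e (grad g q).
    apply: (grad_eq_on_chord (CO _ Cq) (CO _ Cx) (t := t)).
      by rewrite {1}xE s1 scale1r [p + _]addrC subrK.
    by rewrite eq_pq.
  by rewrite s1 mulr1 /eta; lra.
pose Psi x := dot e (grad g x) - N * (V x * V x) + eta * s x.
have Psi_p : Psi p = dot e (grad g p).
  by rewrite /Psi /V subrr sp !mulr0 subr0 addr0.
have Kp : K p by split=> //=; rewrite sp lexx ler01.
have Psi_cont x : D x -> {for x, continuous Psi}.
  move=> Dx; apply: continuousD.
    apply: continuousB; first exact: h_cont.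
    apply: continuousM; first exact: cst_continuous.
    by apply: continuousM; exact: V_cont.
  by apply: continuousM; [exact: cst_continuous|exact: s_cont].
have [m Km max_m] : exists2 m, K m & forall x, K x -> Psi x <= Psi m.
  have [||m mK mmax] := @EVT_max_rV R 2 Psi K _ cK.
  - by exists p.
  - by apply: continuous_in_subspaceT => x /set_mem/KD; exact: Psi_cont.
  - exists m; first exact/set_mem.
    by move=> x Kx; apply: mmax; exact/mem_set.
have nBm : ~ B m.
  by move=> /NP; have := max_m _ Kp; rewrite Psi_p /Psi; lra.
have [/= Cm /andP[s0 s1]] := Km.
have m_int : `|m - c| < r.
  rewrite lt_neqAle Cm andbT; apply/negP => /eqP mr; apply: nBm.
  by split=> //; left.
have sm1 : s m < 1.
  rewrite lt_neqAle s1 andbT; apply/negP => /eqP mr; apply: nBm.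
  by split=> //; right.
have Dm := KD _ Km.
have Psi_der w : is_derive m w Psi (hess g m e w
    - N * (2 * V m * (hess f m e w + hess g m e w)) + eta * dot nu w).
  have dV : is_derive m w V (hess f m e w + hess g m e w).
    rewrite -[X in is_derive _ _ _ X]subr0.
    have de : is_derive m w dsum_e (hess f m e w + hess g m e w).
      exact: (dsum_is_derive e w Dm).
    exact: (@is_deriveB _ _ _ dsum_e (cst (dsum e p))).
  have dh : is_derive m w (fun y => dot e (grad g y)) (hess g m e w).
    exact: (grad_is_derive e w oO gC2 (pair_sub P Dm)).
  have ds : is_derive m w s (dot nu w).
    rewrite -[X in is_derive _ _ _ X]subr0.
    have dn := dot_is_derive nu m w.
    exact: (@is_deriveB _ _ _ (dot nu) (cst (dot nu p))).
  exact: is_derive_penalized.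
have step w : (\forall h \near (0 : R), 0 < h -> 0 <= s m + h * dot nu w <= 1) ->
    hess g m e w - N * (2 * V m * (hess f m e w + hess g m e w))
    + eta * dot nu w <= 0.
  move=> s_near; apply: (is_derive_le (Psi_der w)).
  have intr : \forall h \near (0 : R), `|m + h *: w - c| < r.
    exact: near_line w (@open_lt_dist _ _ c r) m_int.
  apply: filterS2 s_near intr => h sh Ch h0; rewrite mulr0 addr0.
  apply: max_m; split; first exact: ltW.
  by have := sh h0; rewrite /s /= dotDr dotZr addrAC.
have s_qp : \forall h \near (0 : R), 0 < h -> 0 <= s m + h * dot nu (q - p) <= 1.
  have sm1' : 0 < 1 - s m by rewrite subr_gt0.
  apply: filterS (@nbhs0_lt R R _ sm1') => h hs h0; rewrite nu_qp mulr1.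
  move: hs; rewrite gtr0_norm// => hs; apply/andP; split; first lra.
  by rewrite addrC -lerBrDr ltW.
have s_e d : dot nu d = 0 ->
    \forall h \near (0 : R), 0 < h -> 0 <= s m + h * dot nu d <= 1.
  by move=> ->; near=> h; rewrite mulr0 addr0 s0 s1.
have nu_Ne : dot nu (- e) = 0 by rewrite dotC dotNl dotC nu_e oppr0.
have Om := pair_sub P Dm.
have := step (q - p) s_qp; have := step (- e) (s_e _ nu_Ne).
have := step e (s_e _ nu_e).
rewrite nu_Ne nu_e nu_qp !hessNr !mulr0 !addr0 mulr1.
have := pair_parallel e (q - p) Dm.
have := @hess_eq0 _ _ _ _ e (q - p) (pair_l P) Om.
have := @hess_eq0 _ _ _ _ e (q - p) (pair_r P) Om.
have := hess_ge0 (pair_l P) e Om; have := hess_ge0 (pair_r P) e Om.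
move: (hess f m e e) (hess g m e e) (hess f m e (q - p)) (hess g m e (q - p)).
move: (V m) => v a b a' b' b0 a0 bb aa par.
have -> : N * (2 * v * (a + b)) = 2 * N * v * (a + b) by ring.
have -> : N * (2 * v * (- a + - b)) = - (2 * N * v * (a + b)) by ring.
have -> : N * (2 * v * (a' + b')) = 2 * N * v * (a' + b') by ring.
move: (2 * N * v) => k E1 E2 E3.
have bE : b = k * (a + b) by apply/eqP; rewrite eq_le; apply/andP; split; lra.
(* If the sum of the Hessians degenerates along [e], both Hessians kill [e];
   otherwise [par] turns criticality along [e] into criticality along [q - p]. *)
have [ab0|abn0] := eqVneq (a + b) 0.
  have a_eq0 : a = 0 by lra.
  have b_eq0 : b = 0 by lra.
  by move: E3; rewrite (aa a_eq0) (bb b_eq0); lra.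
have ab_gt0 : 0 < a + b by rewrite lt0r abn0 addr_ge0.
have : (a + b) * (b' - k * (a' + b') + eta) <= 0 by rewrite pmulr_rle0.
have -> : (a + b) * (b' - k * (a' + b') + eta)
    = (b' * a + b' * b) - (k * (a + b)) * (a' + b') + (a + b) * eta by ring.
rewrite -bE -par; have := mulr_gt0 ab_gt0 eta0; lra.
Unshelve. all: by end_near. Qed.

(** * The contact set *)

Definition gap2 p x : R := gap f p x + gap g p x.
Definition contact p : set E := [set x | Omega x /\ gap2 p x = 0].

Lemma gap2_ge0 p x : Omega p -> Omega x -> 0 <= gap2 p x.
Proof.
move=> Op Ox; apply: addr_ge0; first exact: (gap_ge0 (pair_l P)).
exact: (gap_ge0 (pair_r P)).
Qed.

Lemma gap2_eq0 p x : Omega p -> contact p x -> gap f p x = 0 /\ gap g p x = 0.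
Proof.
move=> Op [Ox]; have := gap_ge0 (pair_l P) Op Ox; have := gap_ge0 (pair_r P) Op Ox.
by rewrite /gap2; split; lra.
Qed.

Lemma contact_id p : Omega p -> contact p p.
Proof. by move=> Op; split=> //; rewrite /gap2 !gap_id addr0. Qed.

Lemma contact_convex p x y t : Omega p -> contact p x -> contact p y ->
  0 <= t <= 1 -> contact p (t *: x + (1 - t) *: y).
Proof.
move=> Op Cx Cy t01; have [Ox _] := Cx; have [Oy _] := Cy.
have [fx gx] := gap2_eq0 Op Cx; have [fy gy] := gap2_eq0 Op Cy.
have Oz := dom_cvx (pair_l P) Ox Oy t01; split=> //.
have := gap2_ge0 Op Oz; have := gap_convex (pair_l P) p Ox Oy t01.
have := gap_convex (pair_r P) p Ox Oy t01; rewrite fx fy gx gy /gap2 !mulr0 addr0.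
move=> *; lra.
Qed.

Lemma contact_shrink p v t : Omega p -> contact p (p + v) -> 0 <= t <= 1 ->
  contact p (p + t *: v).
Proof.
move=> Op Cv t01.
rewrite (_ : p + t *: v = t *: (p + v) + (1 - t) *: p).
  by apply: contact_convex => //; exact: contact_id.
rewrite scalerDr scalerBl scale1r [t *: p + _]addrC -addrA.
by rewrite [t *: p + _]addrC subrK addrC.
Qed.

Lemma gap2_continuous p x : Omega x -> {for x, continuous (gap2 p)}.
Proof.
move=> Ox; have cf := gap_continuous (p := p) fC2.1 Ox.
have cg := gap_continuous (p := p) gC2.1 Ox.
have := @continuousD _ _ _ (gap f p) (gap g p) x; apply; [exact: cf|exact: cg].
Qed.

Lemma gap2_tangent p x y : Omega x -> Omega y ->
  gap2 p x + dot (y - x) (grad f x - grad f p + (grad g x - grad g p)) <= gap2 p y.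
Proof.
move=> Ox Oy; have := gap_tangent (pair_l P) p Ox Oy.
have := gap_tangent (pair_r P) p Ox Oy.
by rewrite /gap2 [in X in _ -> _ -> X]dotDr => *; lra.
Qed.

(** The gradient of the gap at a point [x] close to [p] with a positive gap
separates [x] from the contact set; these gradients, normalized, accumulate on
the unit sphere, which is compact. *)
Lemma contact_support p : Omega p -> ~ (\forall x \near p, gap2 p x = 0) ->
  exists2 n, n != 0 & forall y, contact p y -> dot n (y - p) <= 0.
Proof.
move=> Op nz; apply: contrapT => nsup.
have sep n : n != 0 -> exists2 y, contact p y & 0 < dot n (y - p).
  move=> n0; apply: contrapT => ny; apply: nsup; exists n => // y Cy.
  by rewrite leNgt; apply/negP => yn; apply: ny; exists y.
have /compact_near_coveringP cS := @compact_eq_dist R 2 0 1.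
have near_sep : \forall x \near p, forall n, `|n - 0| = 1 ->
    exists2 y, contact p y & 0 < dot n (y - x).
  have := cS _ (nbhs p) (fun x n => exists2 y, contact p y & 0 < dot n (y - x)) _.
  apply => n /= n1.
  have n0 : n != 0 by rewrite -normr_gt0 -[n]subr0 n1 ltr01.
  have [y Cy ny] := sep _ n0.
  have ny2 : dot n (y - p) / 2 < dot n (y - p) by lra.
  have dotc : {for n, continuous (fun n' => dot (y - p) n')}.
    exact: dot_continuous.
  have c1 : \forall n' \near n, dot n (y - p) / 2 < dot n' (y - p).
    move: ny2; rewrite {2}dotC => ny2; have h := cvgr_gt _ dotc _ ny2.
    by near=> n'; rewrite [ltRHS]dotC; near: n'; exact: h.
  have c2 : \forall n' \near n, `|n'| < 2.
    have c : {for n, continuous (fun n' : E => `|n'|)} by exact: norm_continuous.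
    have n2 : `|n| < 2 by rewrite -[n]subr0 n1; lra.
    exact: cvgr_lt _ c _ n2.
  have d0 : 0 < dot n (y - p) / 16 by lra.
  have c3 : \forall x \near p, `|x - p| < dot n (y - p) / 16.
    by have := near_dist_lt (c := p) (x := p); apply; rewrite subrr normr0.
  near=> n' x; exists y => //.
  have a1 : dot n (y - p) / 2 < dot n' (y - p) by near: n'; exact: c1.
  have a2 : `|n'| < 2 by near: n'; exact: c2.
  have a3 : `|x - p| < dot n (y - p) / 16 by near: x; exact: c3.
  rewrite (_ : y - x = (y - p) - (x - p)); last by rewrite opprB addrA subrK.
  rewrite dotBr subr_gt0; apply: le_lt_trans (ler_norm _) _.
  apply: le_lt_trans (dot_le _ _) _; apply: lt_trans a1.
  have : `|n'| * `|x - p| <= 2 * (dot n (y - p) / 16).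
    by apply: ler_pM => //; exact: ltW.
  lra.
apply: nz.
have nO := open_nbhs_nbhs (conj oO Op).
move: nO near_sep; apply: filterS2 => x Ox xsep.
apply: contrapT => gx0.
have gx : 0 < gap2 p x.
  by rewrite lt0r (gap2_ge0 Op Ox) andbT; apply/eqP.
set z := grad f x - grad f p + (grad g x - grad g p).
have zle y : contact p y -> dot z (y - x) < 0.
  move=> [Oy gy]; have := gap2_tangent p Ox Oy; rewrite gy -/z dotC; lra.
have z0 : z != 0.
  by apply/eqP => z0; have := zle _ (contact_id Op); rewrite z0 dot0l ltxx.
have nz0 : 0 < `|z| by rewrite normr_gt0.
have [|y Cy] := xsep (`|z|^-1 *: z).
  by rewrite subr0 normrZ ger0_norm ?invr_ge0// mulVf// gt_eqF.
by rewrite dotZl pmulr_rgt0 ?invr_gt0// ltNge ltW// zle.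
Unshelve. all: by end_near. Qed.

(** * Cutting off an extreme contact point *)

Definition extreme_contact p :=
  forall v, contact p (p + v) -> contact p (p - v) -> v = 0.

(** On a line through [p] the contact set is an interval with [p] as an end point,
so one of the two orientations [t] of the line works. *)
Lemma extreme_one_side p n : Omega p -> extreme_contact p -> n != 0 ->
  exists t, (forall x, dot n (x - p) = 0 -> dot t (x - p) = 0 -> x = p) /\
    forall y, contact p y -> dot n (y - p) = 0 -> 0 <= dot t (y - p).
Proof.
move=> Op ext n0.
have pn0 : perp n != 0 by apply/eqP => /perp_eq0/eqP; rewrite (negbTE n0).
have pn_gt0 : 0 < dot (perp n) (perp n) by rewrite lt0r dot_eq0 pn0 dot_ge0.
have on_line x : dot n (x - p) = 0 -> exists s, x = p + s *: perp n.
  move=> nx; have [|s xE] := dot_perp_eq0 (e := perp n) (y := x - p) pn0.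
    rewrite (_ : perp (perp n) = - n) ?dotNl ?nx ?oppr0//.
    by apply: rV2P; rewrite !mxE.
  by exists s; rewrite -xE addrC subrK.
have dotE s : dot (perp n) (p + s *: perp n - p) = s * dot (perp n) (perp n).
  by rewrite addrC addKr dotZr.
have uniq_p (t : E) : t = perp n \/ t = - perp n ->
    forall x, dot n (x - p) = 0 -> dot t (x - p) = 0 -> x = p.
  move=> tE x /on_line[s ->] ts; have : s * dot (perp n) (perp n) = 0.
    by case: tE ts => ->; rewrite ?dotNl dotE// => /eqP; rewrite oppr_eq0 => /eqP.
  move=> /eqP; rewrite mulf_eq0 (gt_eqF pn_gt0) orbF => /eqP ->.
  by rewrite scale0r addr0.
have [pos|/existsNP[y1 /not_implyP[C1 /not_implyP[n1 /negP]]]] :=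
  pselect (forall y, contact p y -> dot n (y - p) = 0 -> 0 <= dot (perp n) (y - p)).
  by exists (perp n); split=> //; apply: uniq_p; left.
rewrite -ltNge => lt1.
exists (- perp n); split; first by apply: uniq_p; right.
move=> y2 C2 n2; rewrite dotNl oppr_ge0 leNgt; apply/negP => gt2.
have [s1 y1E] := on_line _ n1; have [s2 y2E] := on_line _ n2.
move: lt1 gt2; rewrite y1E y2E !dotE pmulr_llt0// pmulr_lgt0// => s1_lt0 s2_gt0.
pose s := Num.min (- s1) s2.
have s_gt0 : 0 < s by rewrite lt_min oppr_gt0 s1_lt0.
have : s *: perp n = 0.
  apply: ext.
    rewrite (_ : s *: perp n = (s / s2) *: (s2 *: perp n)).
      apply: (contact_shrink Op); first by rewrite -y2E.
      by rewrite ler_pdivrMr// mul1r ge_min lexx orbT divr_ge0// ltW.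
    by rewrite scalerA divfK// gt_eqF.
  rewrite (_ : - (s *: perp n) = (s / - s1) *: (s1 *: perp n)).
    apply: (contact_shrink Op); first by rewrite -y1E.
    have Ns1 : 0 < - s1 by rewrite oppr_gt0.
    by rewrite ler_pdivrMr// mul1r ge_min lexx divr_ge0// ltW.
  by rewrite scalerA invrN mulrN mulNr divfK ?lt_eqF// scaleNr.
by move/eqP; rewrite scaler_eq0 (gt_eqF s_gt0) (negbTE pn0).
Qed.

(** The contact set can be cut off near an extreme point: tilting the supporting
line slightly, away from the contact points that it carries, makes the linear
form negative at all contact points of the sphere. A small multiple of this form
then lies below the gap on the whole sphere. *)
Lemma extreme_cap p r : Omega p -> 0 < r -> (forall x, `|x - p| <= r -> Omega x) ->
  ~ (\forall x \near p, gap2 p x = 0) -> extreme_contact p ->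
  exists a, exists2 m, 0 < m &
    forall x, `|x - p| = r -> m < gap2 p x - dot a (x - p).
Proof.
move=> Op r0 rO nz ext.
have [n n0 nsup] := contact_support Op nz.
have [t [tp t0]] := extreme_one_side Op ext n0.
pose S := [set x | `|x - p| = r].
have cS : compact S by exact: compact_eq_dist.
have SO x : S x -> Omega x by move=> xr; apply: rO; rewrite xr.
have Sp x : S x -> x <> p.
  by move=> xr xp; move: xr; rewrite /S /= xp subrr normr0; lra.
(* The first [compact_coef] chooses the tilt, the second one the multiple. *)
have [N NP] : exists N, forall x, S x ->
    0 < N * (gap2 p x + `|dot n (x - p)|) + dot t (x - p).
  apply: compact_coef => //.
  - move=> x /SO Ox; have gc := gap2_continuous (p := p) Ox.
    have nc := @dot_shift_continuous _ _ n p x.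
    have nnc : {for x, continuous (fun x => `|dot n (x - p)|)}.
      exact: (continuous_comp nc (@norm_continuous _ _ _)).
    by have := continuousD gc nnc; exact.
  - by move=> x _; exact: dot_shift_continuous.
  - by move=> x /SO Ox; rewrite addr_ge0// (gap2_ge0).
  move=> x Sx gn0; have Ox := SO _ Sx; have g0 := gap2_ge0 Op Ox.
  have gx : gap2 p x = 0 by have := normr_ge0 (dot n (x - p)); lra.
  have nx : dot n (x - p) = 0.
    by apply/eqP; rewrite -normr_eq0; apply/eqP; move: gn0; rewrite gx add0r.
  rewrite lt0r t0// andbT; apply/eqP => tx; exact: Sp Sx (tp _ nx tx).
have [M MP] : exists M, forall x, S x ->
    0 < M * gap2 p x + (dot t (x - p) - N * dot n (x - p)).
  apply: compact_coef => //.
  - by move=> x /SO Ox; have := gap2_continuous (p := p) Ox; exact.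
  - move=> x _; rewrite (_ : (fun y => _) = (fun y => dot (t - N *: n) (y - p))).
      exact: dot_shift_continuous.
    by apply/funext => y; rewrite [in RHS]dotBl dotZl.
  - by move=> x /SO Ox; rewrite (gap2_ge0).
  move=> x Sx gx; have := NP _ Sx; rewrite gx add0r.
  by rewrite ler0_norm; [lra|apply: nsup; split=> //; exact: SO].
pose M' := `|M| + 1; have M'0 : 0 < M' by rewrite ltr_wpDl.
pose a := M'^-1 *: (N *: n - t).
have [||m m0 mP] := compact_pos (psi := fun x => gap2 p x - dot a (x - p)) cS.
- move=> x /SO Ox; have gc := gap2_continuous (p := p) Ox.
  have nc := @dot_shift_continuous _ _ a p x.
  by have := continuousB gc nc; exact.
- move=> x Sx; rewrite -(pmulr_rgt0 _ M'0) mulrBr dotZl mulrA divff ?gt_eqF// mul1r.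
  apply: lt_le_trans (MP _ Sx) _; rewrite dotBl dotZl opprB.
  apply: lerD => //; apply: ler_wpM2r; first exact: (gap2_ge0 Op (SO _ Sx)).
  by apply: le_trans (ler_norm _) _; rewrite lerDl.
by exists a, m.
Qed.

Definition pos_def_at p := forall v, v != 0 -> 0 < hess f p v v + hess g p v v.

Lemma gap2_is_derive p x v : Omega x ->
  is_derive x v (gap2 p) (dsum v x - dsum v p).
Proof.
move=> Ox.
rewrite (_ : dsum v x - dsum v p = dot v (grad f x) - dot v (grad f p)
  + (dot v (grad g x) - dot v (grad g p))); last by rewrite /dsum opprD addrACA.
have df := gap_is_derive p v oO fC2 Ox; have dg := gap_is_derive p v oO gC2 Ox.
exact: (is_deriveD df dg).
Qed.

(** The point is the minimum of the tilted gap minus a paraboloid small enough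
for the minimum not to reach the sphere. The gradient of [f + g] at this point is
still the slope of a cap around [p], with half the margin. *)
Lemma cap_pos_def p r a m : Omega p -> 0 < r -> 0 < m ->
  (forall x, `|x - p| <= r -> Omega x) ->
  (forall x, `|x - p| = r -> m < gap2 p x - dot a (x - p)) ->
  exists p0, [/\ `|p0 - p| < r, pos_def_at p0 &
    forall x, `|x - p| = r -> m / 2 < gap2 p x - (dsum (x - p) p0 - dsum (x - p) p)].
Proof.
move=> Op r0 m0 rO cap.
have [k k0 kE] : exists2 k, 0 < k & k * (8 * r ^+ 2) = m.
  have r2 : 0 < 8 * r ^+ 2 by rewrite mulr_gt0// exprn_gt0.
  by exists (m / (8 * r ^+ 2)); [exact: divr_gt0|rewrite divfK// gt_eqF].
pose q x := dot (x - p) (x - p).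
have qle x y : `|x - p| <= r -> `|y - p| <= r -> `|dot (x - p) (y - p)| <= 2 * r ^+ 2.
  move=> xr yr; apply: le_trans (dot_le _ _) _.
  by rewrite ler_wpM2l// expr2 ler_pM.
pose W x := gap2 p x - dot a (x - p) - k * q x.
pose C := [set x | `|x - p| <= r].
have Cp : C p by rewrite /C /= subrr normr0 ltW.
have W_cont x : C x -> {for x, continuous W}.
  move=> /rO Ox; have gc := gap2_continuous (p := p) Ox.
  have nc := @dot_shift_continuous _ _ a p x.
  have qc : {for x, continuous q}.
    have -> : q = (fun y => (y 0 0 - p 0 0) * (y 0 0 - p 0 0)
                    + (y 0 1 - p 0 1) * (y 0 1 - p 0 1)).
      by apply/funext => y; rewrite /q dot2E !mxE.
    have cc i : {for x, continuous (fun y : E => y 0 i - p 0 i)}.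
      have := @continuousB _ _ _ (fun y : E => y 0 i) (cst (p 0 i)) x; apply.
        by have := @coord_continuous R 1 2 0 i x; exact.
      exact: cst_continuous.
    have := continuousD (continuousM (cc 0) (cc 0)) (continuousM (cc 1) (cc 1)).
    exact.
  have kqc := continuousM (@cst_continuous _ _ k x) qc.
  by have := continuousB (continuousB gc nc) kqc; exact.
have Wp : W p = 0.
  by rewrite /W /q subrr !(dotC _ 0) !dot0l mulr0 /gap2 !gap_id addr0 !subr0.
have [p0 Cp0 p0min] : exists2 p0, C p0 & forall x, C x -> W p0 <= W x.
  have [||c cC cmin] := @EVT_min_rV R 2 W C _ (@compact_le_dist R 2 p r).
  - by exists p.
  - by apply: continuous_in_subspaceT => x /set_mem; exact: W_cont.
  - exists c; first exact/set_mem.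
    by move=> x Cx; apply: cmin; exact/mem_set.
have Op0 : Omega p0 by exact: rO.
have p0r : `|p0 - p| < r.
  rewrite lt_neqAle; apply/andP; split; last exact: Cp0.
  apply/eqP => p0r; have := p0min _ Cp; rewrite Wp /W => W0.
  have := cap _ p0r; have := qle _ _ Cp0 Cp0; rewrite -/(q p0) ger0_norm ?dot_ge0//.
  move=> q2 mlt; have := ler_wpM2l (ltW k0) q2; move: kE m0; nra.
have near_p0 v : \forall h \near (0 : R), `|p0 + h *: v - p| < r.
  exact: near_line v (@open_lt_dist _ _ p r) p0r.
have qE v h : q (p0 + h *: v) = q p0 + h * (2 * dot v (p0 - p)) + h ^+ 2 * dot v v.
  rewrite /q addrAC; move: (p0 - p) => z.
  rewrite dotDl !dotDr !dotZl !dotZr (dotC z v); ring.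
have above v : \forall h \near (0 : R), gap2 p p0
    + h * (dot a v + 2 * k * dot v (p0 - p)) + k * h ^+ 2 * dot v v
    <= gap2 p (p0 + h *: v).
  apply: filterS (near_p0 v) => h hr; have := p0min _ (ltW hr).
  rewrite /W qE [p0 + _ - p]addrAC (dotDr a (p0 - p)) dotZr.
  move: (dot v v) (dot v _) => b c.
  rewrite (_ : k * (q p0 + h * (2 * c) + h ^+ 2 * b)
    = k * q p0 + h * (2 * k * c) + k * h ^+ 2 * b); last ring.
  rewrite mulrDr; move: (k * q p0) (h * _) (h * _) (k * _ * _) => *; lra.
have dsumN v x : dsum (- v) x = - dsum v x by rewrite /dsum !dotNl opprD.
have dir_ge v : dot a v + 2 * k * dot v (p0 - p) <= dsum v p0 - dsum v p.
  apply: (is_derive_ge (gap2_is_derive p v Op0)).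
  apply: filterS (above v) => h + h0; apply: le_trans; rewrite lerDl.
  by rewrite mulr_ge0 ?dot_ge0// mulr_ge0 ?sqr_ge0// ltW.
have first_order v : dsum v p0 - dsum v p = dot a v + 2 * k * dot v (p0 - p).
  apply/eqP; rewrite eq_le dir_ge andbT; have := dir_ge (- v).
  by rewrite !dsumN dotNl mulrN (dotC a) dotNl (dotC v a); lra.
exists p0; split=> //.
  move=> v v0; have v_gt0 : 0 < dot v v by rewrite lt0r dot_eq0 v0 dot_ge0.
  apply: (@lt_le_trans _ _ (k * dot v v)); first exact: mulr_gt0.
  have Dd : is_derive p0 v (dsum v) (hess f p0 v v + hess g p0 v v).
    by apply: is_deriveD; exact: grad_is_derive Op0.
  apply: (is_derive_ge Dd); apply: filterS2 (above v) (near_p0 v) => h ab hr h0.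
  have Oh : Omega (p0 + h *: v) by apply: rO; exact: ltW.
  have := gap2_tangent p Oh Op0.
  rewrite (_ : p0 - (p0 + h *: v) = - (h *: v)); last by rewrite opprD addNKr.
  move: ab; rewrite -first_order dotNl dotZl dotDr !dotBr /dsum => ab tan.
  rewrite -(ler_pM2l h0).
  move: ab tan; rewrite !mulrDr !mulrN.
  rewrite (_ : h * (h * (k * dot v v)) = k * h ^+ 2 * dot v v); last ring.
  lra.
move=> x xr; rewrite first_order.
have := cap _ xr.
have : `|dot (x - p) (p0 - p)| <= 2 * r ^+ 2 by apply: qle; [rewrite xr|exact: ltW].
have k2 : k * (2 * r ^+ 2) = m / 4.
  have k8 : 4 * (k * (2 * r ^+ 2)) = k * (8 * r ^+ 2) by ring.
  by move: k8; rewrite kE; move: (k * _) => b; lra.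
move=> /(le_trans (ler_norm _))/(ler_wpM2l (ltW k0)); rewrite (dotC a) k2.
rewrite -mulrA; lra.
Qed.

(** A form has zero mixed discriminant with a positive definite one only if it is
zero or indefinite. *)
Lemma hessian_eq0_of_det x : D x -> 0 < \det (hessian f x) -> hessian g x = 0.
Proof.
move=> Dx; have Ox := pair_sub P Dx.
rewrite (det_sym (hessianC oO fC2 Ox)) => d0.
have [h1 h2 h3 h4] := pair_coef Dx.
have [a0 b0 c0] := pos_det_eq0 h1 h2 h3 h4 d0.
have b0' : hessian g x 1 0 = 0 by rewrite (hessianC oO gC2 Ox).
apply/matrixP => i j; rewrite [RHS]mxE.
have two (k : 'I_2) : k = 0 \/ k = 1.
  by case: k => [[|[|//]] ?]; [left|right]; exact/val_inj.
by case: (two i) => ->; case: (two j) => ->; assumption.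
Qed.

(** The determinant is additive on forms with zero mixed discriminant. *)
Lemma pos_def_det p : D p -> pos_def_at p ->
  0 < \det (hessian f p) \/ 0 < \det (hessian g p).
Proof.
move=> Dp pd; have Op := pair_sub P Dp.
have [_ _ h3 h4] := pair_coef Dp.
have [s t st|d0|d0] := pos_def_forms h3 h4; last 2 first.
- by left; rewrite (det_sym (hessianC oO fC2 Op)).
- by right; rewrite (det_sym (hessianC oO gC2 Op)).
pose v : E := \row_i (if i == 0 then s else t).
have [v0 v1] : v 0 0 = s /\ v 0 1 = t by rewrite !mxE.
have vn0 : v != 0.
  apply: contraNneq st => vz; move: v0 v1; rewrite vz !mxE => <- <-.
  by rewrite eqxx.
have := pd v vn0.
by rewrite (hess2E _ _ oO fC2 Op) (hess2E _ _ oO gC2 Op) v0 v1.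
Qed.

(** For [y] near [p0] and [q] near [p], the function [T y], which is the gap of
[f + g] at [p] minus a linear form with the slope of this gap at [y], is minimal at
[y], small at [y] and [q], and large on the sphere around [p]. At a point of the
sphere where [T y] is critical along [e], it is minimal on the line of direction
[e]; so this line misses the segment from [y] to [q], where [T y] is small. Hence
[grad_le_of_strip] applies to [y] and [q] if [e] is orthogonal to the difference
of the gradients of [f + g] at these points. *)
Lemma grad_const_propagates p r p0 m : D p -> 0 < r -> 0 < m ->
  (forall x, `|x - p| <= r -> D x) -> `|p0 - p| < r -> pos_def_at p0 ->
  (forall x, `|x - p| = r -> m < gap2 p x - (dsum (x - p) p0 - dsum (x - p) p)) ->
  0 < \det (hessian f p0) -> \forall q \near p, hessian g q = 0.
Proof.
move=> Dp r0 m0 rD p0r pd bdry det0.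
have Dp0 := rD _ (ltW p0r); have Op0 := pair_sub P Dp0; have Op := pair_sub P Dp.
pose gu y := grad f y + grad g y.
pose T y x := gap2 p x - dot (x - p) (gu y - gu p).
have dsumE v y : dsum v y = dot v (gu y) by rewrite dotDr.
have g0 : \forall x \near p0, grad g x = grad g p0.
  apply: (grad_const_of_hessian oO gC2 Op0).
  have entry i j : {for p0, continuous (fun y => hessian f y i j)}.
    by have := hessian_continuous (i := i) (j := j) fC2 Op0; exact.
  have dc := continuousB (continuousM (entry 0 0) (entry 1 1))
    (continuousM (entry 0 1) (entry 0 1)).
  have dp0 : 0 < hessian f p0 0 0 * hessian f p0 1 1
                 - hessian f p0 0 1 * hessian f p0 0 1.
    by move: det0; rewrite (det_sym (hessianC oO fC2 Op0)) expr2.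
  have nD := open_nbhs_nbhs (conj (pair_open P) Dp0).
  have dgt := cvgr_gt _ dc _ dp0.
  near=> x; have Dx : D x by near: x; exact: nD.
  apply: (hessian_eq0_of_det Dx).
  rewrite (det_sym (hessianC oO fC2 (pair_sub P Dx))) expr2.
  by near: x; exact: dgt.
have T_tangent y x z : Omega x -> Omega z ->
    T y x + dot (z - x) (gu x - gu y) <= T y z.
  move=> Ox Oz; have := gap2_tangent p Ox Oz.
  rewrite (_ : grad f x - grad f p + (grad g x - grad g p) = gu x - gu p).
    rewrite /T (_ : z - p = (z - x) + (x - p)); last by rewrite addrA subrK.
    rewrite (_ : gu x - gu y = (gu x - gu p) - (gu y - gu p)); last first.
      by rewrite opprB addrA subrK.
    rewrite (dotDl (z - x)) (dotBr (z - x) (gu x - gu p)).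
    have lin (a b a' b' k : R) : a + b <= a' -> a - k + (b - b') <= a' - (b' + k).
      by move=> *; lra.
    exact: lin.
  by rewrite /gu opprD addrACA.
have Tpp y : T y p = 0 by rewrite /T subrr dot0l /gap2 !gap_id addr0 subr0.
have Tself y : Omega y -> T y y <= 0.
  move=> Oy; have := T_tangent y _ _ Oy Op.
  by rewrite Tpp subrr dotC dot0l addr0.
have near_gu eps : 0 < eps -> \forall y \near p0, `|gu y - gu p0| < eps.
  move=> eps0; have e2 : 0 < eps / 2 by rewrite divr_gt0.
  apply: filterS2 (near_grad fC2.1 Op0 e2) (near_grad gC2.1 Op0 e2) => y yf yg.
  rewrite /gu opprD addrACA (splitr eps).
  by apply: le_lt_trans (ler_normD _ _) _; exact: ltrD.
have bdry' : \forall y \near p0, forall x, `|x - p| = r -> m / 2 < T y x.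
  have e0 : 0 < m / (8 * r) by rewrite divr_gt0// mulr_gt0.
  apply: filterS (near_gu _ e0) => y ye x xr.
  have TE : T y x = T p0 x - dot (x - p) (gu y - gu p0).
    rewrite /T (_ : gu y - gu p = (gu y - gu p0) + (gu p0 - gu p)).
      by rewrite dotDr opprD addrCA addrC.
    by rewrite addrA subrK.
  have := bdry _ xr; rewrite !dsumE -dotBr -/(T p0 x) TE.
  have : `|dot (x - p) (gu y - gu p0)| <= m / 4.
    apply: le_trans (dot_le _ _) _; rewrite xr.
    apply: (@le_trans _ _ (2 * (r * (m / (8 * r))))).
      by rewrite ler_wpM2l// ler_wpM2l ?ltW.
    by rewrite le_eqVlt; apply/orP; left; apply/eqP; field; exact: lt0r_neq0.
  move=> /(le_trans (ler_norm _)); lra.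
have inner : \forall q \near p, \forall y \near p0, T y q < m / 2.
  pose B := `|gu p0 - gu p| + 1; have B0 : 0 < B by rewrite ltr_wpDl.
  have e0 : 0 < m / (16 * B) by rewrite divr_gt0// mulr_gt0.
  have m4 : gap2 p p < m / 4 by rewrite /gap2 !gap_id addr0 divr_gt0.
  have gc : {for p, continuous (gap2 p)} by have := gap2_continuous (p := p) Op; exact.
  have n1 := cvgr_lt _ gc _ m4.
  have n2 : \forall q \near p, `|q - p| < m / (16 * B).
    by have := near_dist_lt (c := p) (x := p); apply; rewrite subrr normr0.
  near=> q.
  have q1 : gap2 p q < m / 4 by near: q; exact: n1.
  have q2 : `|q - p| < m / (16 * B) by near: q; exact: n2.
  apply: filterS (near_gu _ ltr01) => y y1.
  have yB : `|gu y - gu p| <= B.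
    rewrite (_ : gu y - gu p = (gu p0 - gu p) + (gu y - gu p0)).
      by apply: le_trans (ler_normD _ _) _; rewrite lerD2l ltW.
    by rewrite [RHS]addrC addrA subrK.
  have : `|dot (q - p) (gu y - gu p)| <= m / 8.
    apply: le_trans (dot_le _ _) _.
    apply: (@le_trans _ _ (2 * (m / (16 * B) * B))).
      by rewrite ler_wpM2l// ler_pM// ltW.
    by rewrite le_eqVlt; apply/orP; left; apply/eqP; field; exact: lt0r_neq0.
  rewrite /T => /ler_normlP[le1 _]; lra.
have strip y q e : `|y - p| < r -> `|q - p| < r ->
    (forall x, `|x - p| = r -> m / 2 < T y x) -> T y q < m / 2 ->
    dot e (gu q) = dot e (gu y) ->
    forall x s t, `|x - p| = r -> 0 <= s <= 1 -> x = y + s *: (q - y) + t *: e ->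
    dsum e x <> dsum e y.
  move=> yr qr ybd yq eq_e x s t xr s01 xE; rewrite !dsumE => ex.
  have [Ox Oy Oq] : [/\ Omega x, Omega y & Omega q].
    by split; apply: (pair_sub P); apply: rD; rewrite ?xr//; exact: ltW.
  set z := y + s *: (q - y) in xE.
  have zE : z = s *: q + (1 - s) *: y.
    by rewrite /z scalerBr scalerBl scale1r addrCA addrA [s *: q + _]addrC addrAC.
  have Oz : Omega z by rewrite zE; exact: (dom_cvx (pair_l P)).
  have zx := T_tangent y _ _ Ox Oz; have := ybd _ xr.
  move: zx; rewrite (_ : z - x = - (t *: e)); last by rewrite xE opprD addNKr.
  rewrite dotNl dotZl dotBr ex subrr mulr0 oppr0 addr0 => Txz Tx.
  have zy := T_tangent y _ _ Oz Oy; have zq := T_tangent y _ _ Oz Oq.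
  have Ty := Tself _ Oy.
  have [s0 s1] := andP s01.
  move: zy zq; rewrite (_ : y - z = - s *: (q - y)); last first.
    by rewrite /z opprD addNKr scaleNr.
  rewrite (_ : q - z = (1 - s) *: (q - y)); last first.
    by rewrite /z scalerBl scale1r opprD addrA.
  rewrite !dotZl; move: (dot (q - y) _) => d zy zq.
  have os : 0 <= 1 - s by rewrite subr_ge0.
  have := ler_wpM2l os (le_trans zy Ty).
  have := ler_wpM2l s0 (le_trans zq (ltW yq)).
  have m2 : 0 <= m / 2 by rewrite divr_ge0// ltW.
  have := ler_wpM2r m2 s1.
  rewrite mulr0 mul1r (_ : s * (T y z + (1 - s) * d)
    = T y z - (1 - s) * (T y z + - s * d)); last ring.
  move: (_ * (T y z + _)) => k1; lra.
(* A nonzero [d] would make the derivative of [f + g] along [perp d] constant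
   near [p0], against positive definiteness. *)
have const : \forall q \near p, grad g q = grad g p0.
  have pp : `|p - p| < r by rewrite subrr normr0.
  have nr : \forall q \near p, `|q - p| < r := near_dist_lt pp.
  apply: filterS2 nr inner => q qr inq.
  apply/eqP; rewrite -subr_eq0; apply/negP => /negP d_neq0.
  set d := grad g q - grad g p0 in d_neq0.
  have dk : \forall y \near p0, dsum (perp d) y = dsum (perp d) q.
    have nr0 := near_dist_lt p0r.
    near=> y.
    have yr : `|y - p| < r by near: y; exact: nr0.
    have ybd : forall x, `|x - p| = r -> m / 2 < T y x by near: y; exact: bdry'.
    have yq : T y q < m / 2 by near: y; exact: inq.
    have gy : grad g y = grad g p0 by near: y; exact: g0.
    pose w := gu q - gu y.
    have eE : dot (perp w) (gu q) = dot (perp w) (gu y).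
      by apply/eqP; rewrite -subr_eq0 -dotBr dot_perp.
    have st := strip y q (perp w) yr qr ybd yq eE.
    have dsE : dsum (perp w) q = dsum (perp w) y by rewrite !dsumE.
    have le1 := grad_le_of_strip rD (ltW yr) (ltW qr) dsE st.
    have le2 : dot (perp w) (grad g q) <= dot (perp w) (grad g y).
      apply: (grad_le_of_strip rD (ltW qr) (ltW yr) (esym dsE)).
      move=> x s t xr /andP[s0 s1] xE; rewrite dsE.
      apply: (st x (1 - s) t xr); first by apply/andP; split; lra.
      rewrite xE scalerBl scale1r -!scalerN opprB.
      congr (_ + _); rewrite addrA; congr (_ + _).
      by rewrite addrC subrK.
    have wd : dot (perp w) d = 0.
      by rewrite dotBr -gy; apply/eqP; rewrite subr_eq0 eq_le le2 le1.
    have : dot (perp d) w = 0.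
      by rewrite -[RHS]oppr0 -wd !dot2E !mxE /=; ring.
    by rewrite dotBr !dsumE => /eqP; rewrite subr_eq0 => /eqP.
  have pd0 : perp d != 0 by apply/eqP => /perp_eq0/eqP; rewrite (negbTE d_neq0).
  have := pd _ pd0; rewrite ltNge => /negP; apply.
  apply: (is_derive_le (dsum_is_derive (perp d) (perp d) Dp0)).
  have dkh : \forall h \near (0 : R),
      dsum (perp d) (p0 + h *: perp d) = dsum (perp d) q.
    by have := @line_cvg R E p0 (perp d) _ dk; exact.
  apply: filterS dkh => h -> _.
  by rewrite (nbhs_singleton dk) mulr0 addr0.
have nO := open_nbhs_nbhs (conj oO Op).
move: nO (nbhs_interior const); apply: filterS2 => q Oq.
exact: hessian_eq0_of_grad oO gC2 Oq.
Unshelve. all: by end_near. Qed.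

End degenerate_pair.

(** * Lines of contact *)

Section lines_of_contact.
Context {R : realType}.
Notation E := 'rV[R]_2.
Implicit Types (x y v w e c p : E) (r : R).
Variables (Omega D : set E) (f g : E -> R).
Hypothesis P : degenerate_pair Omega D f g.

Let oO := dom_open (pair_l P).
Local Notation contact := (contact Omega f g).

Definition flat_at x := (\forall y \near x, hessian f y = 0) \/
                        (\forall y \near x, hessian g y = 0).

Lemma gap2_near0_flat p : Omega p -> (\forall x \near p, gap2 f g p x = 0) -> flat_at p.
Proof.
move=> Op g0; left; apply: (hessian_eq0_of_gap (pair_l P) Op).
have nO := open_nbhs_nbhs (conj oO Op).
move: nO g0; apply: filterS2 => x Ox gx.
by have [] := gap2_eq0 P Op (conj Ox gx).
Qed.

(** Otherwise a cap would be cut off near [p]; at the point of positive definite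
Hessian that it contains one of the two Hessians vanishes, and this propagates
to a neighborhood of [p]. *)
Lemma contact_segment_exists p : D p -> ~ flat_at p ->
  exists v, [/\ v != 0, contact p (p + v) & contact p (p - v)].
Proof.
move=> Dp nflat; have Op := pair_sub P Dp; apply: contrapT => nseg.
have ext : extreme_contact Omega f g p.
  move=> v C1 C2; apply/eqP; apply: contrapT => /negP v0.
  by apply: nseg; exists v.
have nz : ~ \forall x \near p, gap2 f g p x = 0.
  by move=> g0; apply: nflat; exact: gap2_near0_flat.
have [d /= d0] := (nbhs_ballP _ _).1 (open_nbhs_nbhs (conj (pair_open P) Dp)).
rewrite -ball_normE => dD.
pose r := d / 2; have r0 : 0 < r by rewrite divr_gt0.
have rD x : `|x - p| <= r -> D x.
  move=> xr; apply: dD; rewrite /= distrC; apply: le_lt_trans xr _.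
  by rewrite /r; lra.
have rO x : `|x - p| <= r -> Omega x by move=> /rD/(pair_sub P).
have [a [m m0 cap]] := extreme_cap P Op r0 rO nz ext.
have [p0 [p0r pd bdry]] := cap_pos_def P Op r0 m0 rO cap.
have m2 : 0 < m / 2 by rewrite divr_gt0.
have [det0|det0] := pos_def_det P (rD _ (ltW p0r)) pd.
  apply: nflat; right.
  exact: (grad_const_propagates P Dp r0 m2 rD p0r pd bdry det0).
apply: nflat; left.
apply: (grad_const_propagates (degenerate_pairC P) Dp r0 m2 rD p0r _ _ det0).
  by move=> v v0; rewrite addrC; exact: pd.
move=> x xr; have := bdry x xr; rewrite /gap2 /dsum.
by rewrite (addrC (gap f p x)) (addrC (dot _ (grad f p0))) (addrC (dot _ (grad f p))).
Qed.

Lemma contact_symm p v t : Omega p -> contact p (p + v) -> contact p (p - v) ->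
  `|t| <= 1 -> contact p (p + t *: v).
Proof.
move=> Op C1 C2 t1; have [t0|t0] := leP 0 t.
  by apply: (contact_shrink P Op C1); rewrite t0 -(ger0_norm t0).
rewrite -[t *: v]opprK -scaleNr -scalerN; apply: (contact_shrink P Op C2).
by rewrite oppr_ge0 (ltW t0) -(ltr0_norm t0).
Qed.

(** The convex hull of the two segments is a parallelogram centered at [p]. *)
Lemma contact_cross p v w : Omega p -> dot (perp v) w != 0 ->
  contact p (p + v) -> contact p (p - v) -> contact p (p + w) -> contact p (p - w) ->
  \forall x \near p, gap2 f g p x = 0.
Proof.
move=> Op vw v1 v2 w1 w2.
have wv : dot (perp w) v = - dot (perp v) w by rewrite !dot2E !mxE /=; ring.
pose s x := dot (perp w) (x - p) / dot (perp w) v.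
pose t x := dot (perp v) (x - p) / dot (perp v) w.
have xE x : x = p + s x *: v + t x *: w.
  have sv : x - p = s x *: v + t x *: w.
    have [k kE] : exists k, k * dot (perp v) w = 1.
      by exists (dot (perp v) w)^-1; rewrite mulVf.
    have sE : s x = - k * dot (perp w) (x - p).
      rewrite /s wv invrN mulrN mulrC -mulNr; congr (- _ * _).
      by apply: (mulIf vw); rewrite mulVf.
    have tE : t x = k * dot (perp v) (x - p).
      by rewrite /t mulrC; congr (_ * _); apply: (mulIf vw); rewrite mulVf.
    move: sE tE kE; rewrite !dot2E !mxE /= => -> -> kE.
    by apply: rV2P; rewrite !mxE; rewrite -[LHS]mul1r -kE; ring.
  by rewrite -addrA -sv addrC subrK.
have small (z : E) k : k != 0 -> \forall x \near p, `|dot z (x - p) / k| < 1 / 2.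
  move=> k0.
  have c : {for p, continuous (fun x => `|dot z (x - p)|)}.
    have nc := @dot_shift_continuous _ _ z p p.
    exact: (continuous_comp nc (@norm_continuous _ _ _)).
  have z0 : `|dot z (p - p)| < `|k| / 2.
    by rewrite subrr dotC dot0l normr0 divr_gt0// normr_gt0.
  have cl := cvgr_lt _ c _ z0.
  near=> x; have zx : `|dot z (x - p)| < `|k| / 2 by near: x; exact: cl.
  by rewrite normrM normfV ltr_pdivrMr ?normr_gt0//; lra.
have wv0 : dot (perp w) v != 0 by rewrite wv oppr_eq0.
apply: filterS2 (small (perp w) _ wv0) (small (perp v) _ vw) => x sx tx.
suff [] : contact p x by [].
rewrite (xE x) (_ : _ + _ = 2^-1 *: (p + (2 * s x) *: v)
  + (1 - 2^-1) *: (p + (2 * t x) *: w)); last first.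
  have h2 : (1 - 2^-1 : R) = 2^-1 by lra.
  rewrite h2 !scalerDr !scalerA !mulrA mulVf// !mul1r [RHS]addrACA -scalerDl.
  by rewrite (_ : 2^-1 + 2^-1 = 1 :> R) ?scale1r ?addrA//; lra.
apply: (contact_convex P Op); last by apply/andP; split; lra.
  apply: contact_symm => //; rewrite normrM ger0_norm//.
  by move: sx; rewrite -/(s x); lra.
apply: contact_symm => //; rewrite normrM ger0_norm//.
by move: tx; rewrite -/(t x); lra.
Unshelve. all: by end_near. Qed.

(** Puts [p] in the position required by [flat_spreads]: [z] is the end of the
segment opposite to [y], or [p] itself if [y] is [p]. *)
Lemma point_between p v y t : Omega p -> y = p + t *: v ->
  contact p (p + v) -> contact p (p - v) ->
  exists k z, [/\ 0 < k <= 1, contact p z & p = k *: y + (1 - k) *: z].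
Proof.
move=> Op yE C1 C2; have t1 : 0 < 1 + `|t| by rewrite ltr_pwDl.
exists (1 + `|t|)^-1, (p + - Num.sg t *: v); split.
- by rewrite invr_gt0 t1 /= invf_le1 ?lerDl.
- apply: (contact_symm Op C1 C2); rewrite normrN normr_sg.
  by case: (t != 0); rewrite ?lexx ?ler01.
set k := (1 + `|t|)^-1.
have kE : (1 - k) * Num.sg t = k * t.
  apply: (mulfI (lt0r_neq0 t1)); rewrite !mulrA mulrBr divff ?gt_eqF//.
  by rewrite mulr1 mul1r addrC addKr mulrC -numEsg.
have lin (a b : R) : a = k * (a + t * b) + (1 - k) * (a + - Num.sg t * b).
  transitivity (a + (k * t - (1 - k) * Num.sg t) * b); last ring.
  by rewrite kE subrr mul0r addr0.
by rewrite yE; apply: rV2P; rewrite !mxE.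
Qed.

Lemma contact_not_flat p y k z : D p -> D y -> ~ flat_at p -> contact p y ->
  contact p z -> 0 < k <= 1 -> p = k *: y + (1 - k) *: z -> ~ flat_at y.
Proof.
move=> Dp Dy nflat Cy Cz k01 pE; have Op := pair_sub P Dp; have Oy := pair_sub P Dy.
have [fy gy] := gap2_eq0 P Op Cy; have [fz gz] := gap2_eq0 P Op Cz.
have [Oz _] := Cz.
case=> Hy; apply: nflat; [left|right].
  exact: (flat_spreads (pair_l P) Op Oy Oz k01 pE fy fz Hy).
exact: (flat_spreads (pair_r P) Op Oy Oz k01 pE gy gz Hy).
Qed.

(** The tangent planes at [y] are those at [p]. *)
Lemma contact_same p y : D p -> contact p y -> forall x, contact y x -> contact p x.
Proof.
move=> Dp Cy; have Op := pair_sub P Dp; have [fy gy] := gap2_eq0 P Op Cy.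
have [Oy _] := Cy.
have fyE := grad_eq_of_gap0 (pair_l P) Op Oy fy.
have gyE := grad_eq_of_gap0 (pair_r P) Op Oy gy.
move=> x [Ox]; rewrite /gap2 (gap_shift _ fy fyE) (gap_shift _ gy gyE) => gx.
by split.
Qed.

(** At [y] the argument starts over and gives a contact segment. If it were not
on the line, its image under the contraction with center [z] that takes [y] to
[p] would cross the given segment at [p], and [p] would be interior to its
contact set. *)
Lemma contact_near_on_line p v y : D p -> D y -> ~ flat_at p -> v != 0 ->
  contact p (p + v) -> contact p (p - v) -> contact p y ->
  range (fun t : R => p + t *: v) y ->
  \forall x \near y, range (fun t : R => p + t *: v) x -> contact p x.
Proof.
move=> Dp Dy nflat v0 C1 C2 Cy [t _ yE]; have Op := pair_sub P Dp.
have [k [z [k01 Cz pE]]] := point_between Op (esym yE) C1 C2.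
have nflat_y := contact_not_flat Dp Dy nflat Cy Cz k01 pE.
have [w [w0 W1 W2]] := contact_segment_exists Dy nflat_y.
have Cp1 := contact_same Dp Cy W1; have Cp2 := contact_same Dp Cy W2.
have [k0 k1] := andP k01; have k01' : 0 <= k <= 1 by rewrite ltW.
have on_line : dot (perp v) w = 0.
  apply/eqP; apply: contrapT => /negP vw; apply: nflat.
  apply: (gap2_near0_flat Op).
  apply: (@contact_cross p v (k *: w)) => //.
  - by rewrite dotC dotZl dotC mulf_neq0// gt_eqF.
  - rewrite [X in contact p X](_ : _ = k *: (y + w) + (1 - k) *: z).
      exact: (contact_convex P Op Cp1 Cz k01').
    by rewrite {1}pE scalerDr addrAC.
  - rewrite [X in contact p X](_ : _ = k *: (y - w) + (1 - k) *: z).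
      exact: (contact_convex P Op Cp2 Cz k01').
    by rewrite {1}pE scalerBr addrAC.
have [s wE] := dot_perp_eq0 v0 on_line.
have s0 : s != 0 by apply: contraNneq w0 => s0; rewrite wE s0 scale0r.
have w_gt0 : `|y - y| < `|w| by rewrite subrr normr0 normr_gt0.
apply: filterS (near_dist_lt w_gt0) => x xy [t' _ xE].
have xyE : x - y = ((t' - t) / s) *: w.
  by rewrite -xE -yE wE scalerA divfK// opprD addrACA subrr add0r scalerBl.
apply: (contact_same Dp Cy).
rewrite (_ : x = y + ((t' - t) / s) *: w); last by rewrite -xyE addrC subrK.
apply: (contact_symm (pair_sub P Dy) W1 W2).
move: xy; rewrite xyE normrZ -[ltRHS]mul1r ltr_pM2r ?normr_gt0//; exact: ltW.
Qed.

Lemma component_contact p : D p -> ~ flat_at p ->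
  exists2 v, v != 0 & forall y,
    connected_component (range (fun t : R => p + t *: v) `&` D) p y ->
    contact p y /\ ~ flat_at y.
Proof.
move=> Dp nflat; have Op := pair_sub P Dp.
have [v [v0 C1 C2]] := contact_segment_exists Dp nflat.
exists v => //; pose L := range (fun t : R => p + t *: v).
pose I := connected_component (L `&` D) p.
have Lp : L p by exists 0 => //; rewrite scale0r addr0.
have IL y : I y -> L y /\ D y by move=> /connected_component_sub.
have IC : I `&` contact p = I.
  apply: (@component_connected _ (L `&` D) p).
  - exists p; split; last exact: (contact_id f g Op).
    exact: connected_component_refl.
  - exists (interior [set x | L x -> contact p x]); first exact: open_interior.
    apply/seteqP; split=> y [Iy].
      move=> Cy; split=> //; have [Ly Dy] := IL _ Iy.
      exact: (contact_near_on_line Dp Dy nflat v0 C1 C2 Cy Ly).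
    by move=> /interior_subset Cy; split=> //; apply: Cy; have [] := IL _ Iy.
  - exists (closure (contact p)); first exact: closed_closure.
    apply/seteqP; split=> y [Iy Cy]; split=> //; first exact: subset_closure.
    have [_ Dy] := IL _ Iy; have Oy := pair_sub P Dy; split=> //.
    apply/eqP; apply: contrapT => /negP gy.
    have gy0 : 0 < gap2 f g p y by rewrite lt0r gy (gap2_ge0 P Op Oy).
    have gc : {for y, continuous (gap2 f g p)}.
      by have := gap2_continuous P (p := p) Oy; exact.
    have [x [[_ gx]]] := Cy _ (cvgr_gt _ gc _ gy0).
    by rewrite /= gx ltxx.
move=> y /= Iy; have Cy : contact p y.
  by move: Iy; rewrite -[connected_component _ _]/I -IC => -[].
split=> //.
have [[t _ yE] Dy] := IL _ Iy.
have [k [z [k01 Cz pE]]] := point_between Op (esym yE) C1 C2.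
exact: (contact_not_flat Dp Dy nflat Cy Cz k01 pE).
Qed.

End lines_of_contact.

(** * Extended-valued convex functions *)

Section extended_valued.
Context {R : realType} {n : nat}.
Notation E := 'rV[R]_n.

(** Separate from [dot] in order to carry a linear structure in [v]. *)
Definition dotr (w v : E) : R := dot v w.
Fact dotr_linear w : GRing.linear_for *%R (dotr w).
Proof. by move=> a u v; rewrite /dotr dotDl dotZl. Qed.
HB.instance Definition _ w :=
  GRing.isLinear.Build R E R _ (dotr w) (dotr_linear w).

Variables (Omega : set E) (f : E -> \bar R).
Hypothesis fin_f : forall x, Omega x -> f x = (fine (f x))%:E.

Lemma affine_on_of_gap p (A : set E) :
  (forall x, A x -> Omega x /\ gap (fine \o f) p x = 0) ->
  affine_on A f.
Proof.
move=> A0; exists (dotr (grad (fine \o f) p)).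
exists (fine (f p) - dot p (grad (fine \o f) p)) => x /A0[Ox].
rewrite /gap dotBl /= => gx; rewrite fin_f//; congr _%:E.
by rewrite /dotr; lra.
Qed.

End extended_valued.

Lemma Conv_fine (R : realType) (Omega : set 'rV[R]_2) (f : 'rV[R]_2 -> \bar R) :
  Conv Omega f -> forall x, Omega x -> f x = (fine (f x))%:E.
Proof.
move=> [[fNy _] _ fdom] x Ox; rewrite fineK// fin_numE fNy /=.
by rewrite lt_eqF//; exact: fdom.
Qed.

Lemma Conv_convexC2 (R : realType) (Omega : set 'rV[R]_2) (f : 'rV[R]_2 -> \bar R) :
  open Omega -> convex_set (Omega : set (convex_lmodType 'rV[R]_2)) ->
  Conv Omega f -> C2_on Omega (fine \o f) -> convexC2 Omega (fine \o f).
Proof.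
move=> oO cO fConv fC2.
have seg x y t : Omega x -> Omega y -> 0 <= t <= 1 -> Omega (t *: x + (1 - t) *: y).
  move=> Ox Oy /andP[t0 t1].
  have := cO x y (Itv01 t0 t1) (mem_set Ox) (mem_set Oy).
  by move/set_mem.
apply: (ConvexC2 oO seg fC2) => x y t Ox Oy t01.
have finf := Conv_fine fConv; have [_ cvx _] := fConv.
have := cvx x y t t01.
rewrite (finf _ (seg _ _ _ Ox Oy t01)) (finf _ Ox) (finf _ Oy).
by rewrite -!EFinM -EFinD lee_fin.
Qed.

Theorem corollary1p18 (R : realType) (Omega D : set 'rV[R]_2)
    (f g : 'rV[R]_2 -> \bar R)
    (oOmega : open Omega)
    (cvxOmega : convex_set (Omega : set (convex_lmodType 'rV[R]_2)))
    (DOmega : D `<=` Omega) (oD : open D) (cD : connected D)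
    (fConv : Conv Omega f) (gConv : Conv Omega g)
    (fC2 : C2_on Omega (fine \o f)) (gC2 : C2_on Omega (fine \o g))
    (fg0 : forall x, D x ->
       mixed_discriminant (hessian (fine \o f) x) (hessian (fine \o g) x) = 0) :
  let flat := locally_zero_hessian D (fine \o f) `|`
              locally_zero_hessian D (fine \o g) in
  forall x, (D `\` flat) x ->
    exists L : set 'rV[R]_2,
      [/\ affine_line L, L x &
          let I := connected_component (L `&` D) x in
          [/\ affine_on I f, affine_on I g & I `&` flat = set0]].
Proof.
move=> flat x [Dx nflat].
have P : degenerate_pair Omega D (fine \o f) (fine \o g).
  exact: (DegeneratePair (Conv_convexC2 oOmega cvxOmega fConv fC2)
    (Conv_convexC2 oOmega cvxOmega gConv gC2) oD DOmega fg0).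
have nflat_x : ~ flat_at (fine \o f) (fine \o g) x.
  by case=> H; apply: nflat; [left|right]; split.
have [v v0 Icontact] := component_contact P Dx nflat_x.
exists (range (fun t : R => x + t *: v)); split.
- by exists x, v.
- by exists 0 => //; rewrite scale0r addr0.
have Ox := DOmega _ Dx; split.
- apply: (affine_on_of_gap (Conv_fine fConv) (p := x)) => y /Icontact[Cy _].
  by split; [case: Cy|have [] := gap2_eq0 P Ox Cy].
- apply: (affine_on_of_gap (Conv_fine gConv) (p := x)) => y /Icontact[Cy _].
  by split; [case: Cy|have [] := gap2_eq0 P Ox Cy].
apply/seteqP; split=> // y [/Icontact[_ nflat_y] flat_y]; apply: nflat_y.
by case: flat_y => -[_ H]; [left|right].
Qed.
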